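(* Let $F\colon\mathcal C\to\mathcal D$ be a perfect tensor functor between finite tensor categories and $\mathcal M$ an exact left $\mathcal D$-module category. There is a natural isomorphism $$\chi_F\triangleright F^*\bigl(\mathbb S^{\mathcal D}_{\mathcal M}\bigr)\;\cong\;\mathbb S^{\mathcal C}_{{}_F\mathcal M}$$ of twisted $\mathcal C$-module functors, where $\chi_F\triangleright-\colon{}_F\mathcal M\to{}_F\mathcal M$ is the $\mathcal C$-module functor given by the action of the relative modular object.
   Context: Work over an algebraically closed field $\Bbbk$. A finite tensor category is a finite $\Bbbk$-linear abelian rigid monoidal category with bilinear tensor product and $\mathrm{End}(\mathbb 1)\cong\Bbbk$; a tensor functor is an exact $\Bbbk$-linear strong monoidal functor. Right duals $c^\vee$ have $c^\vee\otimes c\to\mathbb 1$ and $\mathbb 1\to c\otimes c^\vee$. $F$ is perfect if its right adjoint $F^{\mathrm{ra}}$ is exact; then $F^{\mathrm{rra}}=(F^{\mathrm{ra}})^{\mathrm{ra}}$ exists. A module category (action exact in each variable on a finite $\Bbbk$-linear category) is exact if $p\triangleright m$ is projective for all projective $p$ and all $m$. ${}_F\mathcal M$ is $\mathcal M$ with $\mathcal C$-action $c\triangleright^Fm=F(c)\triangleright m$; it is exact since $F$ is perfect. Relative modular object: let ${}_F\mathcal D_F$ be $\mathcal D$ as a $\mathcal C$-bimodule category via $F(c)\otimes d\otimes F(c')$. $F\colon\mathcal C\to{}_F\mathcal D_F$ and its iterated adjoints are $\mathcal C$-bimodule functors. $\chi_F:=F^{\mathrm{rra}}(\mathbb 1)\in\mathcal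 D$ is invertible and carries the half-braiding $\sigma_c\colon\chi_F\otimes F(c)\cong F^{\mathrm{rra}}(c)\cong F(c)\otimes\chi_F$ from the bimodule structure of $F^{\mathrm{rra}}$. The functor $\chi_F\triangleright-\colon{}_F\mathcal M\to{}_F\mathcal M$ is a $\mathcal C$-module functor via $\chi_F\triangleright(F(c)\triangleright m)\xrightarrow{\sigma_c\triangleright\mathrm{id}}F(c)\triangleright(\chi_F\triangleright m)$. Relative Serre functor: with internal Hom $\mathrm{Hom}_{\mathcal M}(d\triangleright m,n)\cong\mathrm{Hom}_{\mathcal D}(d,\underline{\mathrm{Hom}}^{\mathcal D}_{\mathcal M}(m,n))$, the relative Serre functor of an exact $\mathcal D$-module category is the essentially unique endofunctor $\mathbb S^{\mathcal D}_{\mathcal M}$ with natural isomorphisms $\underline{\mathrm{Hom}}(m,n)^\vee\cong\underline{\mathrm{Hom}}(n,\mathbb S^{\mathcal D}_{\mathcal M}(m))$. It has a canonical twisted module structure $\mathfrak s_{d,m}\colon\mathbb S^{\mathcal D}_{\mathcal M}(d\triangleright m)\cong d^{\vee\vee}\triangleright\mathbb S^{\mathcal D}_{\mathcal M}(m)$. $F^*(\mathbb S^{\mathcal D}_{\mathcal M})$ is the same functor with twisted $\mathcal C$-structure $\mathfrak s_{F(c),m}$, where $F(c)^{\vee\vee}$ is identified with $F(c^{\vee\vee})$ via the canonical isomorphism. Thus $\chi_F\triangleright F^*(\mathbb S^{\mathcal D}_{\mathcal M})$ has twisted $\mathcal C$-module structure $\chi_F\triangleright\mathbb S(F(c)\triangleright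 m)\xrightarrow{\mathrm{id}\triangleright\mathfrak s}\chi_F\triangleright(F(c^{\vee\vee})\triangleright\mathbb S(m))\xrightarrow{\sigma_{c^{\vee\vee}}\triangleright\mathrm{id}}F(c^{\vee\vee})\triangleright(\chi_F\triangleright\mathbb S(m))$. *)

(* Defs.v *)
Set Warnings "-notation-overridden,-ambiguous-paths".
From mathcomp Require Import all_boot all_algebra.

Set Implicit Arguments.
Unset Strict Implicit.
Unset Printing Implicit Defensive.

Import GRing.Theory.
Local Open Scope ring_scope.

Local Obligation Tactic := intros; simpl.

Declare Scope cat_scope.
Delimit Scope cat_scope with cat.
Local Open Scope cat_scope.

(* Finite-dimensionality of the morphism spaces, which is part of the
   definition of a finite k-linear category, is built in through [vectType]. *)
Record lincat (k : fieldType) := LinCat {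
  ob :> Type;
  Hom : ob -> ob -> vectType k;
  idm : forall a, Hom a a;
  compm : forall a b c, Hom b c -> Hom a b -> Hom a c;
  comp1m : forall a b (f : Hom a b), compm (idm b) f = f;
  compm1 : forall a b (f : Hom a b), compm f (idm a) = f;
  compA : forall a b c d (h : Hom c d) (g : Hom b c) (f : Hom a b),
    compm h (compm g f) = compm (compm h g) f;
  compPl : forall a b c (x : k) (g g' : Hom b c) (f : Hom a b),
    compm (x *: g + g') f = x *: compm g f + compm g' f;
  compPr : forall a b c (x : k) (g : Hom b c) (f f' : Hom a b),
    compm g (x *: f + f') = x *: compm g f + compm g f' }.

Arguments Hom {k l} a b.
Arguments idm {k l} a.
Arguments compm {k l a b c} g f.

Notation "g ∘ f" := (compm g f)
  (at level 40, left associativity, format "g  ∘  f") : cat_scope.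

Record iso (k : fieldType) (C : lincat k) (a b : C) := Iso {
  fwd : Hom a b;
  bwd : Hom b a;
  fwdK : bwd ∘ fwd = idm a;
  bwdK : fwd ∘ bwd = idm b }.

Arguments fwd {k C a b} i.
Arguments bwd {k C a b} i.

Section Abelian.
Variables (k : fieldType) (C : lincat k).
Implicit Types a b c s p x y z : C.

Definition is_zero z :=
  (forall a (f g : Hom a z), f = g) /\ (forall a (f g : Hom z a), f = g).

Definition mono x y (f : Hom x y) :=
  forall t (u v : Hom t x), f ∘ u = f ∘ v -> u = v.

Definition epi x y (f : Hom x y) :=
  forall t (u v : Hom y t), u ∘ f = v ∘ f -> u = v.

Definition invertible x y (f : Hom x y) := exists i : iso x y, fwd i = f.

Definition is_kernel a x y (i : Hom a x) (f : Hom x y) :=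
  f ∘ i = 0 /\
  forall t (u : Hom t x), f ∘ u = 0 -> exists! v : Hom t a, i ∘ v = u.

Definition is_cokernel x y c (f : Hom x y) (q : Hom y c) :=
  q ∘ f = 0 /\
  forall t (u : Hom y t), u ∘ f = 0 -> exists! v : Hom c t, v ∘ q = u.

Definition is_biproduct x y p (i : Hom x p) (j : Hom y p)
    (q : Hom p x) (r : Hom p y) :=
  [/\ q ∘ i = idm x, r ∘ j = idm y, q ∘ j = 0, r ∘ i = 0
    & i ∘ q + j ∘ r = idm p].

Record abelian_category : Prop := Abelian {
  ab_zero : exists z, is_zero z;
  ab_biproduct : forall x y, exists p (i : Hom x p) (j : Hom y p)
    (q : Hom p x) (r : Hom p y), is_biproduct i j q r;
  ab_kernel : forall x y (f : Hom x y), exists a (i : Hom a x), is_kernel i f;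
  ab_cokernel : forall x y (f : Hom x y),
    exists c (q : Hom y c), is_cokernel f q;
  ab_mono : forall x y (f : Hom x y), mono f ->
    exists z (g : Hom y z), is_kernel f g;
  ab_epi : forall x y (f : Hom x y), epi f ->
    exists z (g : Hom z x), is_cokernel g f }.

Definition short_exact a b c (i : Hom a b) (q : Hom b c) :=
  is_kernel i q /\ is_cokernel i q.

Definition simple_object s :=
  ~ is_zero s /\
  forall a (i : Hom a s), mono i -> is_zero a \/ invertible i.

Inductive finite_length : C -> Prop :=
| FLzero z : is_zero z -> finite_length z
| FLext a b s (i : Hom a b) (q : Hom b s) :
    finite_length a -> simple_object s -> short_exact i q -> finite_length b.

Definition projective p :=
  forall x y (q : Hom x y) (f : Hom p y), epi q ->
  exists g : Hom p x, q ∘ g = f.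

Record finite_category : Prop := FiniteCategory {
  fin_abelian :> abelian_category;
  fin_length : forall x, finite_length x;
  fin_projectives : forall x,
    exists p (q : Hom p x), projective p /\ epi q;
  fin_simples : exists (n : nat) (S : 'I_n -> C),
    forall s, simple_object s -> exists i, inhabited (iso s (S i)) }.

End Abelian.

Record functor (k : fieldType) (C D : lincat k) := Functor {
  fob :> C -> D;
  fhom : forall a b, Hom a b -> Hom (fob a) (fob b);
  fhom1 : forall a, fhom (idm a) = idm (fob a);
  fhomM : forall a b c (g : Hom b c) (f : Hom a b),
    fhom (g ∘ f) = fhom g ∘ fhom f;
  fhomP : forall a b (x : k) (f g : Hom a b),
    fhom (x *: f + g) = x *: fhom f + fhom g }.

Arguments fhom {k C D} F {a b} f : rename.

Definition exact_functor (k : fieldType) (C D : lincat k) (F : functor C D) :=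
  forall a b c (i : Hom a b) (q : Hom b c),
  short_exact i q -> short_exact (fhom F i) (fhom F q).

Section FunctorComp.
Variables (k : fieldType) (C D E : lincat k).
Variables (G : functor D E) (F : functor C D).

Program Definition functor_comp : functor C E :=
  @Functor k C E (fun a => G (F a)) (fun a b f => fhom G (fhom F f)) _ _ _.
Next Obligation. by rewrite !fhom1. Qed.
Next Obligation. by rewrite !fhomM. Qed.
Next Obligation. by rewrite !fhomP. Qed.

End FunctorComp.

Record bifunctor (k : fieldType) (A B E : lincat k) := Bifunctor {
  bob :> A -> B -> E;
  bhom : forall a a' b b', Hom a a' -> Hom b b' -> Hom (bob a b) (bob a' b');
  bhom1 : forall a b, bhom (idm a) (idm b) = idm (bob a b);
  bhomM : forall a a' a'' b b' b'' (f' : Hom a' a'') (f : Hom a a')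
    (g' : Hom b' b'') (g : Hom b b'),
    bhom (f' ∘ f) (g' ∘ g) = bhom f' g' ∘ bhom f g;
  bhomPl : forall a a' b b' (x : k) (f f' : Hom a a') (g : Hom b b'),
    bhom (x *: f + f') g = x *: bhom f g + bhom f' g;
  bhomPr : forall a a' b b' (x : k) (f : Hom a a') (g g' : Hom b b'),
    bhom f (x *: g + g') = x *: bhom f g + bhom f g' }.

Arguments bhom {k A B E} T {a a' b b'} f g : rename.

Section Bifunctors.
Variables (k : fieldType) (A B E : lincat k) (T : bifunctor A B E).

Program Definition bifunctor_l (b : B) : functor A E :=
  @Functor k A E (fun a => T a b) (fun a a' f => bhom T f (idm b)) _ _ _.
Next Obligation. by rewrite bhom1. Qed.
Next Obligation. by rewrite -bhomM compm1. Qed.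
Next Obligation. by rewrite bhomPl. Qed.

Program Definition bifunctor_r (a : A) : functor B E :=
  @Functor k B E (fun b => T a b) (fun b b' f => bhom T (idm a) f) _ _ _.
Next Obligation. by rewrite bhom1. Qed.
Next Obligation. by rewrite -bhomM compm1. Qed.
Next Obligation. by rewrite bhomPr. Qed.

Program Definition precomp_l A' (F : functor A' A) : bifunctor A' B E :=
  @Bifunctor k A' B E (fun a b => T (F a) b)
    (fun a a' b b' f g => bhom T (fhom F f) g) _ _ _ _.
Next Obligation. by rewrite fhom1 bhom1. Qed.
Next Obligation. by rewrite fhomM bhomM. Qed.
Next Obligation. by rewrite fhomP bhomPl. Qed.
Next Obligation. by rewrite bhomPr. Qed.

Program Definition precomp_r B' (F : functor B' B) : bifunctor A B' E :=
  @Bifunctor k A B' E (fun a b => T a (F b))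
    (fun a a' b b' f g => bhom T f (fhom F g)) _ _ _ _.
Next Obligation. by rewrite fhom1 bhom1. Qed.
Next Obligation. by rewrite fhomM bhomM. Qed.
Next Obligation. by rewrite bhomPl. Qed.
Next Obligation. by rewrite fhomP bhomPr. Qed.

End Bifunctors.

Section IsoOperations.
Variable k : fieldType.

Program Definition iso_sym (C : lincat k) (a b : C) (i : iso a b) : iso b a :=
  Iso (bwdK i) (fwdK i).

Program Definition iso_trans (C : lincat k) (a b c : C)
    (i : iso a b) (j : iso b c) : iso a c :=
  @Iso k C a c (fwd j ∘ fwd i) (bwd i ∘ bwd j) _ _.
Next Obligation. by rewrite -compA (compA (bwd j)) fwdK comp1m fwdK. Qed.
Next Obligation. by rewrite -compA (compA (fwd i)) bwdK comp1m bwdK. Qed.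

Program Definition iso_refl (C : lincat k) (a : C) : iso a a :=
  @Iso k C a a (idm a) (idm a) _ _.
Next Obligation. by rewrite comp1m. Qed.
Next Obligation. by rewrite comp1m. Qed.

Program Definition functor_iso (C D : lincat k) (F : functor C D) (a b : C)
    (i : iso a b) : iso (F a) (F b) :=
  @Iso k D _ _ (fhom F (fwd i)) (fhom F (bwd i)) _ _.
Next Obligation. by rewrite -fhomM fwdK fhom1. Qed.
Next Obligation. by rewrite -fhomM bwdK fhom1. Qed.

Program Definition bifunctor_iso (A B E : lincat k) (T : bifunctor A B E)
    a a' b b' (i : iso a a') (j : iso b b') : iso (T a b) (T a' b') :=
  @Iso k E _ _ (bhom T (fwd i) (fwd j)) (bhom T (bwd i) (bwd j)) _ _.
Next Obligation. by rewrite -bhomM !fwdK bhom1. Qed.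
Next Obligation. by rewrite -bhomM !bwdK bhom1. Qed.

End IsoOperations.

Record moncat (k : fieldType) := MonCat {
  mon_cat :> lincat k;
  tens : bifunctor mon_cat mon_cat mon_cat;
  one : mon_cat;
  assoc : forall a b c, iso (tens (tens a b) c) (tens a (tens b c));
  lun : forall a, iso (tens one a) a;
  run : forall a, iso (tens a one) a;
  assoc_nat : forall a a' b b' c c'
    (f : Hom a a') (g : Hom b b') (h : Hom c c'),
    fwd (assoc a' b' c') ∘ bhom tens (bhom tens f g) h
    = bhom tens f (bhom tens g h) ∘ fwd (assoc a b c);
  lun_nat : forall a a' (f : Hom a a'),
    fwd (lun a') ∘ bhom tens (idm one) f = f ∘ fwd (lun a);
  run_nat : forall a a' (f : Hom a a'),
    fwd (run a') ∘ bhom tens f (idm one) = f ∘ fwd (run a);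
  pentagon : forall a b c d,
    bhom tens (idm a) (fwd (assoc b c d)) ∘ fwd (assoc a (tens b c) d)
      ∘ bhom tens (fwd (assoc a b c)) (idm d)
    = fwd (assoc a b (tens c d)) ∘ fwd (assoc (tens a b) c d);
  triangle : forall a b,
    bhom tens (idm a) (fwd (lun b)) ∘ fwd (assoc a one b)
    = bhom tens (fwd (run a)) (idm b) }.

Arguments tens {k m}.
Arguments one {k m}.
Arguments assoc {k m} a b c.
Arguments lun {k m} a.
Arguments run {k m} a.

Notation "a ⊗ b" := (bob tens a b)
  (at level 38, left associativity, format "a  ⊗  b") : cat_scope.
Notation "f ⊠ g" := (bhom tens f g)
  (at level 38, left associativity, format "f  ⊠  g") : cat_scope.
Notation "𝟙" := one : cat_scope.

Record monfunctor (k : fieldType) (C D : moncat k) := MonFunctor {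
  mon_fun :> functor C D;
  mon_two : forall a b, iso (mon_fun a ⊗ mon_fun b) (mon_fun (a ⊗ b));
  mon_unit : iso 𝟙 (mon_fun 𝟙);
  mon_two_nat : forall a a' b b' (f : Hom a a') (g : Hom b b'),
    fwd (mon_two a' b') ∘ (fhom mon_fun f ⊠ fhom mon_fun g)
    = fhom mon_fun (f ⊠ g) ∘ fwd (mon_two a b);
  mon_assoc : forall a b c,
    fhom mon_fun (fwd (assoc a b c)) ∘ fwd (mon_two (a ⊗ b) c)
      ∘ (fwd (mon_two a b) ⊠ idm (mon_fun c))
    = fwd (mon_two a (b ⊗ c)) ∘ (idm (mon_fun a) ⊠ fwd (mon_two b c))
      ∘ fwd (assoc (mon_fun a) (mon_fun b) (mon_fun c));
  mon_lun : forall a,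
    fhom mon_fun (fwd (lun a)) ∘ fwd (mon_two 𝟙 a)
      ∘ (fwd mon_unit ⊠ idm (mon_fun a))
    = fwd (lun (mon_fun a));
  mon_run : forall a,
    fhom mon_fun (fwd (run a)) ∘ fwd (mon_two a 𝟙)
      ∘ (idm (mon_fun a) ⊠ fwd mon_unit)
    = fwd (run (mon_fun a)) }.

Arguments mon_two {k C D} F a b : rename.
Arguments mon_unit {k C D} F : rename.

Record laction (k : fieldType) (C : moncat k) (X : lincat k) := LAction {
  lact : bifunctor C X X;
  lassoc : forall c d x, iso (lact (c ⊗ d) x) (lact c (lact d x));
  lunit : forall x, iso (lact 𝟙 x) x;
  lassoc_nat : forall c c' d d' x x'
    (f : Hom c c') (g : Hom d d') (h : Hom x x'),
    fwd (lassoc c' d' x') ∘ bhom lact (f ⊠ g) h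
    = bhom lact f (bhom lact g h) ∘ fwd (lassoc c d x);
  lunit_nat : forall x x' (h : Hom x x'),
    fwd (lunit x') ∘ bhom lact (idm 𝟙) h = h ∘ fwd (lunit x);
  lpentagon : forall a b c x,
    bhom lact (idm a) (fwd (lassoc b c x)) ∘ fwd (lassoc a (b ⊗ c) x)
      ∘ bhom lact (fwd (assoc a b c)) (idm x)
    = fwd (lassoc a b (lact c x)) ∘ fwd (lassoc (a ⊗ b) c x);
  ltriangle : forall c x,
    bhom lact (idm c) (fwd (lunit x)) ∘ fwd (lassoc c 𝟙 x)
    = bhom lact (fwd (run c)) (idm x) }.

Arguments lact {k C X} l.
Arguments lassoc {k C X} l c d x.
Arguments lunit {k C X} l x.

Record raction (k : fieldType) (C : moncat k) (X : lincat k) := RAction {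
  ract : bifunctor X C X;
  rassoc : forall x c d, iso (ract (ract x c) d) (ract x (c ⊗ d));
  runit : forall x, iso (ract x 𝟙) x;
  rassoc_nat : forall x x' c c' d d'
    (h : Hom x x') (f : Hom c c') (g : Hom d d'),
    fwd (rassoc x' c' d') ∘ bhom ract (bhom ract h f) g
    = bhom ract h (f ⊠ g) ∘ fwd (rassoc x c d);
  runit_nat : forall x x' (h : Hom x x'),
    fwd (runit x') ∘ bhom ract h (idm 𝟙) = h ∘ fwd (runit x);
  rpentagon : forall x a b c,
    bhom ract (idm x) (fwd (assoc a b c)) ∘ fwd (rassoc x (a ⊗ b) c)
      ∘ bhom ract (fwd (rassoc x a b)) (idm c)
    = fwd (rassoc x a (b ⊗ c)) ∘ fwd (rassoc (ract x a) b c);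
  rtriangle : forall x c,
    bhom ract (idm x) (fwd (lun c)) ∘ fwd (rassoc x 𝟙 c)
    = bhom ract (fwd (runit x)) (idm c) }.

Arguments ract {k C X} r.
Arguments rassoc {k C X} r x c d.
Arguments runit {k C X} r x.

Record bimodule (k : fieldType) (C : moncat k) (X : lincat k) := Bimodule {
  bi_l :> laction C X;
  bi_r :> raction C X;
  bi_mid : forall c x d,
    iso (ract bi_r (lact bi_l c x) d) (lact bi_l c (ract bi_r x d));
  bi_mid_nat : forall c c' x x' d d'
    (f : Hom c c') (h : Hom x x') (g : Hom d d'),
    fwd (bi_mid c' x' d') ∘ bhom (ract bi_r) (bhom (lact bi_l) f h) g
    = bhom (lact bi_l) f (bhom (ract bi_r) h g) ∘ fwd (bi_mid c x d);
  bi_pentagon_l : forall a b x d,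
    fwd (lassoc bi_l a b (ract bi_r x d)) ∘ fwd (bi_mid (a ⊗ b) x d)
    = bhom (lact bi_l) (idm a) (fwd (bi_mid b x d))
      ∘ fwd (bi_mid a (lact bi_l b x) d)
      ∘ bhom (ract bi_r) (fwd (lassoc bi_l a b x)) (idm d);
  bi_pentagon_r : forall a x c d,
    bhom (lact bi_l) (idm a) (fwd (rassoc bi_r x c d))
      ∘ fwd (bi_mid a (ract bi_r x c) d)
      ∘ bhom (ract bi_r) (fwd (bi_mid a x c)) (idm d)
    = fwd (bi_mid a x (c ⊗ d)) ∘ fwd (rassoc bi_r (lact bi_l a x) c d) }.

Arguments bi_mid {k C X} B c x d : rename.

Section ModuleFunctors.
Variables (k : fieldType) (C : moncat k) (X Y : lincat k).

Record lmodfunctor (A : laction C X) (B : laction C Y) (G : functor X Y) :=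
  LModFunctor {
  lmod : forall c x, iso (G (lact A c x)) (lact B c (G x));
  lmod_nat : forall c c' x x' (f : Hom c c') (h : Hom x x'),
    fwd (lmod c' x') ∘ fhom G (bhom (lact A) f h)
    = bhom (lact B) f (fhom G h) ∘ fwd (lmod c x);
  lmod_assoc : forall c d x,
    fwd (lassoc B c d (G x)) ∘ fwd (lmod (c ⊗ d) x)
    = bhom (lact B) (idm c) (fwd (lmod d x)) ∘ fwd (lmod c (lact A d x))
      ∘ fhom G (fwd (lassoc A c d x));
  lmod_unit : forall x,
    fwd (lunit B (G x)) ∘ fwd (lmod 𝟙 x) = fhom G (fwd (lunit A x)) }.

Record rmodfunctor (A : raction C X) (B : raction C Y) (G : functor X Y) :=
  RModFunctor {
  rmod : forall x c, iso (G (ract A x c)) (ract B (G x) c);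
  rmod_nat : forall x x' c c' (h : Hom x x') (f : Hom c c'),
    fwd (rmod x' c') ∘ fhom G (bhom (ract A) h f)
    = bhom (ract B) (fhom G h) f ∘ fwd (rmod x c);
  rmod_assoc : forall x c d,
    fwd (rmod x (c ⊗ d)) ∘ fhom G (fwd (rassoc A x c d))
    = fwd (rassoc B (G x) c d) ∘ bhom (ract B) (fwd (rmod x c)) (idm d)
      ∘ fwd (rmod (ract A x c) d);
  rmod_unit : forall x,
    fwd (runit B (G x)) ∘ fwd (rmod x 𝟙) = fhom G (fwd (runit A x)) }.

Record bimodfunctor (A : bimodule C X) (B : bimodule C Y) :=
  BimodFunctor {
  bm_fun :> functor X Y;
  bm_l : lmodfunctor A B bm_fun;
  bm_r : rmodfunctor A B bm_fun;
  bm_mid : forall c x d,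
    fwd (bi_mid B c (bm_fun x) d)
      ∘ bhom (ract B) (fwd (lmod bm_l c x)) (idm d)
      ∘ fwd (rmod bm_r (lact A c x) d)
    = bhom (lact B) (idm c) (fwd (rmod bm_r x d))
      ∘ fwd (lmod bm_l c (ract A x d)) ∘ fhom bm_fun (fwd (bi_mid A c x d)) }.

End ModuleFunctors.

Arguments lmod {k C X Y A B G} l c x.
Arguments rmod {k C X Y A B G} r x c.
Arguments bm_l {k C X Y A B} G : rename.
Arguments bm_r {k C X Y A B} G : rename.

Record adjunction (k : fieldType) (X Y : lincat k)
    (L : functor X Y) (R : functor Y X) := Adjunction {
  adj_unit : forall x, Hom x (R (L x));
  adj_counit : forall y, Hom (L (R y)) y;
  adj_unit_nat : forall x x' (f : Hom x x'),
    adj_unit x' ∘ f = fhom R (fhom L f) ∘ adj_unit x;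
  adj_counit_nat : forall y y' (g : Hom y y'),
    adj_counit y' ∘ fhom L (fhom R g) = g ∘ adj_counit y;
  adj_triangle_l : forall x,
    adj_counit (L x) ∘ fhom L (adj_unit x) = idm (L x);
  adj_triangle_r : forall y,
    fhom R (adj_counit y) ∘ adj_unit (R y) = idm (R y) }.

Arguments adj_unit {k X Y L R} a x.
Arguments adj_counit {k X Y L R} a y.

(* An adjunction whose unit and counit are bimodule transformations.  Given
   the bimodule functor [L], this condition determines the bimodule structure
   of a right adjoint [R] uniquely: it is the one by mates. *)
Record bimod_adjunction (k : fieldType) (C : moncat k) (X Y : lincat k)
    (A : bimodule C X) (B : bimodule C Y)
    (L : bimodfunctor A B) (R : bimodfunctor B A) := BimodAdjunction {
  bi_adj :> adjunction L R;
  bi_unit_l : forall c x,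
    fwd (lmod (bm_l R) c (L x)) ∘ fhom R (fwd (lmod (bm_l L) c x))
      ∘ adj_unit bi_adj (lact A c x)
    = bhom (lact A) (idm c) (adj_unit bi_adj x);
  bi_unit_r : forall x c,
    fwd (rmod (bm_r R) (L x) c) ∘ fhom R (fwd (rmod (bm_r L) x c))
      ∘ adj_unit bi_adj (ract A x c)
    = bhom (ract A) (adj_unit bi_adj x) (idm c);
  bi_counit_l : forall c y,
    bhom (lact B) (idm c) (adj_counit bi_adj y)
      ∘ fwd (lmod (bm_l L) c (R y)) ∘ fhom L (fwd (lmod (bm_l R) c y))
    = adj_counit bi_adj (lact B c y);
  bi_counit_r : forall y c,
    bhom (ract B) (adj_counit bi_adj y) (idm c)
      ∘ fwd (rmod (bm_r L) (R y) c) ∘ fhom L (fwd (rmod (bm_r R) y c))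
    = adj_counit bi_adj (ract B y c) }.

Section Regular.
Variables (k : fieldType) (C : moncat k).

Definition regular_l : laction C C :=
  @LAction k C C tens assoc lun (@assoc_nat k C) (@lun_nat k C)
    (@pentagon k C) (@triangle k C).

Definition regular_r : raction C C :=
  @RAction k C C tens assoc run (@assoc_nat k C) (@run_nat k C)
    (@pentagon k C) (@triangle k C).

Definition regular : bimodule C C :=
  @Bimodule k C C regular_l regular_r assoc (@assoc_nat k C)
    (fun a b x d => esym (@pentagon k C a b x d)) (@pentagon k C).

End Regular.

Section CatLemmas.
Variables (k : fieldType) (C : lincat k).

Lemma iso_swap_r (a b c : C) (i : iso a b) (f : Hom b c) (g : Hom a c) :
  f ∘ fwd i = g -> f = g ∘ bwd i.
Proof. by move=> <-; rewrite -compA bwdK compm1. Qed.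

Lemma iso_swap_l (a b c : C) (i : iso b c) (f : Hom a b) (g : Hom a c) :
  fwd i ∘ f = g -> f = bwd i ∘ g.
Proof. by move=> <-; rewrite compA fwdK comp1m. Qed.

Lemma iso_epi (a b c : C) (i : iso a b) (f g : Hom b c) :
  f ∘ fwd i = g ∘ fwd i -> f = g.
Proof. by move/iso_swap_r=> ->; rewrite -compA bwdK compm1. Qed.

Lemma iso_mono (a b c : C) (i : iso b c) (f g : Hom a b) :
  fwd i ∘ f = fwd i ∘ g -> f = g.
Proof. by move/iso_swap_l=> ->; rewrite compA fwdK comp1m. Qed.

End CatLemmas.

Section BifunctorLemmas.
Variables (k : fieldType) (A B E : lincat k) (T : bifunctor A B E).

Lemma bhom_lr a a' b b' (f : Hom a a') (g : Hom b b') :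
  bhom T f g = bhom T f (idm b') ∘ bhom T (idm a) g.
Proof. by rewrite -bhomM comp1m compm1. Qed.

Lemma bhom_rl a a' b b' (f : Hom a a') (g : Hom b b') :
  bhom T f g = bhom T (idm a') g ∘ bhom T f (idm b).
Proof. by rewrite -bhomM comp1m compm1. Qed.

Lemma bhomMl a a' a'' b (f' : Hom a' a'') (f : Hom a a') :
  bhom T (f' ∘ f) (idm b) = bhom T f' (idm b) ∘ bhom T f (idm b).
Proof. by rewrite -bhomM comp1m. Qed.

Lemma bhomMr a b b' b'' (g' : Hom b' b'') (g : Hom b b') :
  bhom T (idm a) (g' ∘ g) = bhom T (idm a) g' ∘ bhom T (idm a) g.
Proof. by rewrite -bhomM comp1m. Qed.

End BifunctorLemmas.


Section MonFunctorLemmas.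
Variables (k : fieldType) (C D : moncat k) (F : monfunctor C D).

Lemma mon_two_nat_bwd a a' b b' (f : Hom a a') (g : Hom b b') :
  bwd (mon_two F a' b') ∘ fhom F (f ⊠ g)
  = (fhom F f ⊠ fhom F g) ∘ bwd (mon_two F a b).
Proof.
apply: (iso_mono (i := mon_two F a' b')).
by rewrite !compA bwdK comp1m mon_two_nat -compA bwdK compm1.
Qed.

Definition mon_three_l a b c : iso (F a ⊗ F b ⊗ F c) (F (a ⊗ b ⊗ c)) :=
  iso_trans (bifunctor_iso tens (mon_two F a b) (iso_refl (F c)))
    (mon_two F (a ⊗ b) c).

Definition mon_three_r a b c : iso (F a ⊗ (F b ⊗ F c)) (F (a ⊗ (b ⊗ c))) :=
  iso_trans (bifunctor_iso tens (iso_refl (F a)) (mon_two F b c))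
    (mon_two F a (b ⊗ c)).

Lemma mon_three a b c :
  fhom F (fwd (assoc a b c)) ∘ fwd (mon_three_l a b c)
  = fwd (mon_three_r a b c) ∘ fwd (assoc (F a) (F b) (F c)).
Proof. by rewrite /= compA mon_assoc. Qed.

Lemma mon_three_bwd a b c :
  bwd (mon_three_r a b c) ∘ fhom F (fwd (assoc a b c))
  = fwd (assoc (F a) (F b) (F c)) ∘ bwd (mon_three_l a b c).
Proof.
apply/esym/iso_swap_l; rewrite compA -mon_three -compA bwdK.
by rewrite compm1.
Qed.

Lemma mon_lun_bwd a :
  fwd (lun (F a)) ∘ (bwd (mon_unit F) ⊠ idm (F a)) ∘ bwd (mon_two F 𝟙 a)
  = fhom F (fwd (lun a)).
Proof.
rewrite -mon_lun -!compA (compA (_ ⊠ _)) -bhomMl bwdK bhom1 comp1m.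
by rewrite bwdK compm1.
Qed.

Lemma mon_run_bwd a :
  fwd (run (F a)) ∘ (idm (F a) ⊠ bwd (mon_unit F)) ∘ bwd (mon_two F a 𝟙)
  = fhom F (fwd (run a)).
Proof.
rewrite -mon_run -!compA (compA (_ ⊠ _)) -bhomMr bwdK bhom1 comp1m.
by rewrite bwdK compm1.
Qed.

End MonFunctorLemmas.

Section Restriction.
Variables (k : fieldType) (C D : moncat k) (F : monfunctor C D).
Variable X : lincat k.

Section Left.
Variable A : laction D X.

Let act := precomp_l (lact A) F.

Definition restrict_lassoc c d x : iso (act (c ⊗ d) x) (act c (act d x)) :=
  iso_trans
    (bifunctor_iso (lact A) (iso_sym (mon_two F c d)) (iso_refl x))
    (lassoc A (F c) (F d) x).

Definition restrict_lunit x : iso (act 𝟙 x) x :=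
  iso_trans (bifunctor_iso (lact A) (iso_sym (mon_unit F)) (iso_refl x))
    (lunit A x).

Lemma restrict_lassoc_two c d x :
  fwd (restrict_lassoc c d x) ∘ bhom (lact A) (fwd (mon_two F c d)) (idm x)
  = fwd (lassoc A (F c) (F d) x).
Proof. by rewrite /= -compA -bhomMl fwdK bhom1 compm1. Qed.

Fact restrict_lassoc_nat c c' d d' x x'
    (f : Hom c c') (g : Hom d d') (h : Hom x x') :
  fwd (restrict_lassoc c' d' x') ∘ bhom act (f ⊠ g) h
  = bhom act f (bhom act g h) ∘ fwd (restrict_lassoc c d x).
Proof.
by rewrite /= -compA -bhomM mon_two_nat_bwd comp1m compA -lassoc_nat -compA
  -bhomM compm1.
Qed.

Fact restrict_lunit_nat x x' (h : Hom x x') :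
  fwd (restrict_lunit x') ∘ bhom act (idm 𝟙) h = h ∘ fwd (restrict_lunit x).
Proof.
rewrite /= fhom1 -compA -bhomM comp1m compm1.
by rewrite bhom_rl compA lunit_nat compA.
Qed.

Fact restrict_lpentagon a b c x :
  bhom act (idm a) (fwd (restrict_lassoc b c x))
    ∘ fwd (restrict_lassoc a (b ⊗ c) x)
    ∘ bhom act (fwd (assoc a b c)) (idm x)
  = fwd (restrict_lassoc a b (act c x)) ∘ fwd (restrict_lassoc (a ⊗ b) c x).
Proof.
set i := bifunctor_iso (lact A) (mon_three_l F a b c) (iso_refl x).
apply: (iso_epi (i := i)).
have -> : fwd (restrict_lassoc a b (act c x))
    ∘ fwd (restrict_lassoc (a ⊗ b) c x) ∘ fwd i
  = fwd (lassoc A (F a) (F b) (lact A (F c) x))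
    ∘ fwd (lassoc A (F a ⊗ F b) (F c) x).
  rewrite /i /= -!compA -!bhomM (compA (bwd _)) fwdK !comp1m lassoc_nat.
  by rewrite bhom1 (compA (bhom _ _ _)) -bhomMl fwdK bhom1 comp1m.
have -> : bhom act (idm a) (fwd (restrict_lassoc b c x))
      ∘ fwd (restrict_lassoc a (b ⊗ c) x)
      ∘ bhom act (fwd (assoc a b c)) (idm x) ∘ fwd i
  = bhom (lact A) (idm (F a)) (fwd (restrict_lassoc b c x))
    ∘ (fwd (lassoc A (F a) (F (b ⊗ c)) x)
       ∘ bhom (lact A) (idm (F a) ⊠ fwd (mon_two F b c)) (idm x))
    ∘ bhom (lact A) (fwd (assoc (F a) (F b) (F c))) (idm x).
  rewrite /i /= fhom1 -!compA -!bhomM !comp1m (compA (fhom _ _)).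
  by rewrite mon_assoc -!compA (compA (bwd _)) fwdK comp1m.
rewrite lassoc_nat compA -bhomMr restrict_lassoc_two.
exact: lpentagon.
Qed.

Fact restrict_ltriangle c x :
  bhom act (idm c) (fwd (restrict_lunit x)) ∘ fwd (restrict_lassoc c 𝟙 x)
  = bhom act (fwd (run c)) (idm x).
Proof.
rewrite /= fhom1 -mon_run_bwd !bhomMr !bhomMl -ltriangle -!compA.
congr (_ ∘ _); rewrite !compA; congr (_ ∘ _).
by rewrite -lassoc_nat.
Qed.

Definition restrict_l : laction C X :=
  LAction restrict_lassoc_nat restrict_lunit_nat
    restrict_lpentagon restrict_ltriangle.

End Left.

Section Right.
Variable A : raction D X.

Let act := precomp_r (ract A) F.

Definition restrict_rassoc x c d : iso (act (act x c) d) (act x (c ⊗ d)) :=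
  iso_trans (rassoc A x (F c) (F d))
    (bifunctor_iso (ract A) (iso_refl x) (mon_two F c d)).

Definition restrict_runit x : iso (act x 𝟙) x :=
  iso_trans (bifunctor_iso (ract A) (iso_refl x) (iso_sym (mon_unit F)))
    (runit A x).

Fact restrict_rassoc_nat x x' c c' d d'
    (h : Hom x x') (f : Hom c c') (g : Hom d d') :
  fwd (restrict_rassoc x' c' d') ∘ bhom act (bhom act h f) g
  = bhom act h (f ⊠ g) ∘ fwd (restrict_rassoc x c d).
Proof.
by rewrite /= -compA rassoc_nat !compA -!bhomM mon_two_nat comp1m compm1.
Qed.

Fact restrict_runit_nat x x' (h : Hom x x') :
  fwd (restrict_runit x') ∘ bhom act h (idm 𝟙) = h ∘ fwd (restrict_runit x).
Proof.
rewrite /= fhom1 -compA -bhomM comp1m compm1.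
by rewrite bhom_lr compA runit_nat compA.
Qed.

Fact restrict_rpentagon x a b c :
  bhom act (idm x) (fwd (assoc a b c)) ∘ fwd (restrict_rassoc x (a ⊗ b) c)
    ∘ bhom act (fwd (restrict_rassoc x a b)) (idm c)
  = fwd (restrict_rassoc x a (b ⊗ c)) ∘ fwd (restrict_rassoc (act x a) b c).
Proof.
rewrite /= fhom1 bhomMl -!compA.
rewrite (compA (fwd (rassoc A x (F (a ⊗ b)) (F c)))) rassoc_nat.
rewrite !compA -!bhomMr mon_assoc !bhomMr -!compA.
have P := rpentagon A x (F a) (F b) (F c); rewrite -compA in P.
rewrite P (compA (fwd (rassoc _ _ _ _))) -(bhom1 (ract A) x (F a)).
by rewrite rassoc_nat -!compA.
Qed.

Fact restrict_rtriangle x c :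
  bhom act (idm x) (fwd (lun c)) ∘ fwd (restrict_rassoc x 𝟙 c)
  = bhom act (fwd (restrict_runit x)) (idm c).
Proof.
rewrite /= fhom1 bhomMl -rtriangle -[RHS]compA rassoc_nat !compA -!bhomMr.
by rewrite -mon_lun_bwd -compA fwdK compm1.
Qed.

Definition restrict_r : raction C X :=
  RAction restrict_rassoc_nat restrict_runit_nat
    restrict_rpentagon restrict_rtriangle.

End Right.

Section Bi.
Variable A : bimodule D X.

Let L := restrict_l A.
Let R := restrict_r A.

Let mid c x d : iso (ract R (lact L c x) d) (lact L c (ract R x d)) :=
  bi_mid A (F c) x (F d).

Fact restrict_mid_nat c c' x x' d d'
    (f : Hom c c') (h : Hom x x') (g : Hom d d') :
  fwd (mid c' x' d') ∘ bhom (ract R) (bhom (lact L) f h) g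
  = bhom (lact L) f (bhom (ract R) h g) ∘ fwd (mid c x d).
Proof. exact: bi_mid_nat. Qed.

Fact restrict_bi_pentagon_l a b x d :
  fwd (lassoc L a b (ract R x d)) ∘ fwd (mid (a ⊗ b) x d)
  = bhom (lact L) (idm a) (fwd (mid b x d))
    ∘ fwd (mid a (lact L b x) d)
    ∘ bhom (ract R) (fwd (lassoc L a b x)) (idm d).
Proof.
rewrite /= !fhom1 bhomMl !compA -bi_pentagon_l -!compA.
by rewrite bi_mid_nat bhom1.
Qed.

Fact restrict_bi_pentagon_r a x c d :
  bhom (lact L) (idm a) (fwd (rassoc R x c d))
    ∘ fwd (mid a (ract R x c) d)
    ∘ bhom (ract R) (fwd (mid a x c)) (idm d)
  = fwd (mid a x (c ⊗ d)) ∘ fwd (rassoc R (lact L a x) c d).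
Proof.
have P := bi_pentagon_r A (F a) x (F c) (F d); rewrite -compA in P.
by rewrite /= !fhom1 bhomMr -!compA P !compA -bi_mid_nat bhom1.
Qed.

Definition restrict : bimodule C X :=
  Bimodule restrict_mid_nat restrict_bi_pentagon_l restrict_bi_pentagon_r.

End Bi.

End Restriction.

Section MonFunctorBimod.
Variables (k : fieldType) (C D : moncat k) (F : monfunctor C D).

Let A := regular C.
Let B := restrict F (regular D).

Let two c d : iso (F (c ⊗ d)) (F c ⊗ F d) := iso_sym (mon_two F c d).

Fact mon_lmod_assoc c d x :
  fwd (lassoc B c d (F x)) ∘ fwd (two (c ⊗ d) x)
  = bhom (lact B) (idm c) (fwd (two d x)) ∘ fwd (two c (lact A d x))
    ∘ fhom F (fwd (lassoc A c d x)).
Proof.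
have P := mon_three_bwd F c d x; rewrite /= in P.
by rewrite /= fhom1 P compA.
Qed.

Fact mon_lmod_unit x :
  fwd (lunit B (F x)) ∘ fwd (two 𝟙 x) = fhom F (fwd (lunit A x)).
Proof. exact: mon_lun_bwd. Qed.

Definition mon_lmod : lmodfunctor A B F :=
  @LModFunctor k C C D A B F two (@mon_two_nat_bwd k C D F)
    mon_lmod_assoc mon_lmod_unit.

Fact mon_rmod_assoc x c d :
  fwd (two x (c ⊗ d)) ∘ fhom F (fwd (rassoc A x c d))
  = fwd (rassoc B (F x) c d) ∘ bhom (ract B) (fwd (two x c)) (idm d)
    ∘ fwd (two (ract A x c) d).
Proof.
have P := mon_three_bwd F x c d; rewrite /= in P.
by rewrite /= fhom1 -!compA -P !compA -bhomMr bwdK bhom1 comp1m.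
Qed.

Fact mon_rmod_unit x :
  fwd (runit B (F x)) ∘ fwd (two x 𝟙) = fhom F (fwd (runit A x)).
Proof. exact: mon_run_bwd. Qed.

Definition mon_rmod : rmodfunctor A B F :=
  @RModFunctor k C C D A B F two (@mon_two_nat_bwd k C D F)
    mon_rmod_assoc mon_rmod_unit.

Fact mon_bimod_mid c x d :
  fwd (bi_mid B c (F x) d)
    ∘ bhom (ract B) (fwd (lmod mon_lmod c x)) (idm d)
    ∘ fwd (rmod mon_rmod (lact A c x) d)
  = bhom (lact B) (idm c) (fwd (rmod mon_rmod x d))
    ∘ fwd (lmod mon_lmod c (ract A x d)) ∘ fhom F (fwd (bi_mid A c x d)).
Proof.
have P := mon_three_bwd F c x d; rewrite /= in P.
by rewrite /= !fhom1 P compA.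
Qed.

Definition mon_bimod : bimodfunctor A B := BimodFunctor mon_bimod_mid.

End MonFunctorBimod.

Section Kelly.
Variables (k : fieldType) (C : moncat k).

Lemma tens_id_r_inj (a b : C) (f g : Hom a b) :
  f ⊠ idm 𝟙 = g ⊠ idm 𝟙 -> f = g.
Proof.
move=> e; apply: (iso_epi (i := run a)).
by rewrite -!run_nat e.
Qed.

Section Left.
Variables (X : lincat k) (A : laction C X).

Lemma lact_id_inj x y (f g : Hom x y) :
  bhom (lact A) (idm 𝟙) f = bhom (lact A) (idm 𝟙) g -> f = g.
Proof.
move=> e; apply: (iso_epi (i := lunit A x)).
by rewrite -!lunit_nat e.
Qed.

Lemma lunit_lassoc c x :
  fwd (lunit A (lact A c x)) ∘ fwd (lassoc A 𝟙 c x)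
  = bhom (lact A) (fwd (lun c)) (idm x).
Proof.
apply: lact_id_inj.
apply: (iso_epi (i := lassoc A 𝟙 (𝟙 ⊗ c) x)).
apply: (iso_epi (i := bifunctor_iso (lact A) (assoc 𝟙 𝟙 c) (iso_refl x))).
rewrite bhomMr /= -lassoc_nat -!compA -bhomMl triangle.
have P := lpentagon A 𝟙 𝟙 c x; rewrite -compA in P; rewrite P.
by rewrite compA ltriangle -(bhom1 (lact A)) lassoc_nat.
Qed.

End Left.

Lemma lun_assoc (a b : C) :
  fwd (lun (a ⊗ b)) ∘ fwd (assoc 𝟙 a b) = fwd (lun a) ⊠ idm b.
Proof. exact: (lunit_lassoc (regular C)). Qed.

Lemma run_assoc (a b : C) :
  (idm a ⊠ fwd (run b)) ∘ fwd (assoc a b 𝟙) = fwd (run (a ⊗ b)).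
Proof.
apply: tens_id_r_inj.
apply: (iso_mono (i := assoc a b 𝟙)).
rewrite bhomMl compA assoc_nat -!triangle bhomMr -!compA.
have P := pentagon a b (𝟙 : C) 𝟙; rewrite -compA in P; rewrite P.
rewrite !compA; congr (_ ∘ _).
by rewrite -(bhom1 tens) -assoc_nat.
Qed.

Lemma lun_one : fwd (lun (𝟙 : C)) = fwd (run 𝟙).
Proof.
apply: tens_id_r_inj.
rewrite -triangle -lun_assoc; congr (_ ∘ _).
by apply: (iso_mono (i := lun 𝟙)); rewrite lun_nat.
Qed.

End Kelly.

Lemma swap_tens (k : fieldType) (C : moncat k) (c d : C) :
  fwd (assoc c d 𝟙) ∘ (bwd (run (c ⊗ d)) ∘ fwd (lun (c ⊗ d)))
    ∘ fwd (assoc 𝟙 c d)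
  = (idm c ⊠ (bwd (run d) ∘ fwd (lun d))) ∘ fwd (assoc c 𝟙 d)
    ∘ ((bwd (run c) ∘ fwd (lun c)) ⊠ idm d).
Proof.
rewrite -!compA lun_assoc bhomMr bhomMl -[RHS]compA.
rewrite (compA (idm c ⊠ fwd (lun d))) triangle (compA (fwd (run c) ⊠ _)).
rewrite -bhomMl bwdK bhom1 comp1m compA; congr (_ ∘ _).
apply: (iso_mono (i := bifunctor_iso tens (iso_refl c) (run d))).
by rewrite /= compA run_assoc bwdK -bhomMr bwdK bhom1.
Qed.

Record half_braiding (k : fieldType) (C D : moncat k) (F : monfunctor C D)
    (z : D) := HalfBraiding {
  hb : forall c, iso (z ⊗ F c) (F c ⊗ z);
  hb_nat : forall c c' (f : Hom c c'),
    fwd (hb c') ∘ (idm z ⊠ fhom F f) = (fhom F f ⊠ idm z) ∘ fwd (hb c);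
  hb_tens : forall c d,
    fwd (assoc (F c) (F d) z)
      ∘ (bwd (mon_two F c d) ⊠ idm z) ∘ fwd (hb (c ⊗ d))
      ∘ (idm z ⊠ fwd (mon_two F c d)) ∘ fwd (assoc z (F c) (F d))
    = (idm (F c) ⊠ fwd (hb d)) ∘ fwd (assoc (F c) z (F d))
      ∘ (fwd (hb c) ⊠ idm (F d));
  hb_one :
    fwd (lun z) ∘ (bwd (mon_unit F) ⊠ idm z) ∘ fwd (hb 𝟙)
    = fwd (run z) ∘ (idm z ⊠ bwd (mon_unit F)) }.

Arguments hb {k C D F z} h c.

Section BimodHalfBraiding.
Variables (k : fieldType) (C D : moncat k) (F : monfunctor C D).
Variable G : bimodfunctor (regular C) (restrict F (regular D)).

(* G(1) ⊗ F(c) ≅ G(1 ⊗ c) ≅ G(c ⊗ 1) ≅ F(c) ⊗ G(1) *)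
Definition bimod_hb (c : C) : iso (G 𝟙 ⊗ F c) (F c ⊗ G 𝟙) :=
  iso_trans (iso_sym (rmod (bm_r G) 𝟙 c))
    (iso_trans (functor_iso G (iso_trans (lun c) (iso_sym (run c))))
      (lmod (bm_l G) c 𝟙)).

Let B := restrict F (regular D).

Lemma bimod_hb_nat c c' (f : Hom c c') :
  fwd (bimod_hb c') ∘ (idm (G 𝟙) ⊠ fhom F f)
  = (fhom F f ⊠ idm (G 𝟙)) ∘ fwd (bimod_hb c).
Proof.
apply: (iso_epi (i := rmod (bm_r G) 𝟙 c)).
have Pr := rmod_nat (bm_r G) (idm 𝟙) f.
have Pl := lmod_nat (bm_l G) f (idm 𝟙).
rewrite /= !fhom1 in Pr Pl.
rewrite /= -!compA -Pr fwdK compm1 !compA -Pl -!compA.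
congr (_ ∘ _); rewrite (compA (bwd _)) fwdK comp1m -!fhomM -!compA.
rewrite lun_nat !compA; congr (fhom _ (_ ∘ _)).
apply/esym/iso_swap_l.
by rewrite compA run_nat -compA bwdK compm1.
Qed.

Lemma bimod_hb_tens_restrict c d :
  fwd (lassoc B c d (G 𝟙)) ∘ fwd (bimod_hb (c ⊗ d))
    ∘ fwd (rassoc B (G 𝟙) c d)
  = (idm (F c) ⊠ fwd (bimod_hb d)) ∘ fwd (assoc (F c) (G 𝟙) (F d))
    ∘ (fwd (bimod_hb c) ⊠ idm (F d)).
Proof.
pose i := bifunctor_iso tens (rmod (bm_r G) 𝟙 c) (iso_refl (F d)).
apply: (iso_epi (i := i)).
apply: (iso_epi (i := rmod (bm_r G) (𝟙 ⊗ c) d)).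
have hbE e : fwd (bimod_hb e) ∘ fwd (rmod (bm_r G) 𝟙 e)
    = fwd (lmod (bm_l G) e 𝟙) ∘ fhom G (bwd (run e) ∘ fwd (lun e)).
  by rewrite /= -!compA fwdK compm1.
have Ra : fwd (rmod (bm_r G) 𝟙 (c ⊗ d)) ∘ fhom G (fwd (assoc 𝟙 c d))
    = fwd (rassoc B (G 𝟙) c d) ∘ fwd i ∘ fwd (rmod (bm_r G) (𝟙 ⊗ c) d).
  have := rmod_assoc (bm_r G) (𝟙 : C) c d.
  by rewrite /= fhom1.
have La := lmod_assoc (bm_l G) c d (𝟙 : C).
have Rn := rmod_nat (bm_r G) (bwd (run c) ∘ fwd (lun c)) (idm d).
have Ln := lmod_nat (bm_l G) (idm c) (bwd (run d) ∘ fwd (lun d)).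
have Mi := bm_mid G c (𝟙 : C) d.
rewrite /= !fhom1 in Rn Ln Mi.
have -> : fwd (lassoc B c d (G 𝟙)) ∘ fwd (bimod_hb (c ⊗ d))
    ∘ fwd (rassoc B (G 𝟙) c d) ∘ fwd i ∘ fwd (rmod (bm_r G) (𝟙 ⊗ c) d)
  = fwd (lassoc B c d (G 𝟙)) ∘ (fwd (bimod_hb (c ⊗ d))
    ∘ (fwd (rmod (bm_r G) 𝟙 (c ⊗ d)) ∘ fhom G (fwd (assoc 𝟙 c d)))).
  by rewrite Ra !compA.
rewrite (compA (fwd (bimod_hb _))) hbE !compA La.
have Sw := swap_tens c d; rewrite -!compA in Sw.
rewrite -!compA -!fhomM -!compA [LHS]/= Sw {La Ra}.
have -> : (fwd (bimod_hb c) ⊠ idm (F d))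
    ∘ (fwd i ∘ fwd (rmod (bm_r G) (𝟙 ⊗ c) d))
  = (fwd (lmod (bm_l G) c 𝟙) ⊠ idm (F d))
    ∘ ((fhom G (bwd (run c) ∘ fwd (lun c)) ⊠ idm (F d))
    ∘ fwd (rmod (bm_r G) (𝟙 ⊗ c) d)).
  by rewrite !compA -!bhomMl hbE.
rewrite -Rn (compA (_ ⊠ idm (F d))) (compA (fwd (assoc _ _ _))).
rewrite (compA (fwd (assoc _ _ _))) Mi -!compA -fhomM.
rewrite (compA (idm (F c) ⊠ fwd (bimod_hb d))) -bhomMr hbE.
rewrite [in RHS]bhomMr -!compA.
rewrite (compA (idm (F c) ⊠ fhom G _)) -Ln -!compA -fhomM.
by rewrite fhom1.
Qed.

Lemma bimod_hb_one :
  fwd (lunit B (G 𝟙)) ∘ fwd (bimod_hb 𝟙) = fwd (runit B (G 𝟙)).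
Proof.
apply: (iso_epi (i := rmod (bm_r G) 𝟙 𝟙)).
have Lu := lmod_unit (bm_l G) 𝟙.
have Ru := rmod_unit (bm_r G) 𝟙.
rewrite /= in Lu Ru.
rewrite /= -!compA fwdK compm1 !compA Lu [RHS]Ru -fhomM compA lun_one.
by rewrite bwdK comp1m.
Qed.

Fact bimod_hb_tens c d :
  fwd (assoc (F c) (F d) (G 𝟙))
    ∘ (bwd (mon_two F c d) ⊠ idm (G 𝟙)) ∘ fwd (bimod_hb (c ⊗ d))
    ∘ (idm (G 𝟙) ⊠ fwd (mon_two F c d)) ∘ fwd (assoc (G 𝟙) (F c) (F d))
  = (idm (F c) ⊠ fwd (bimod_hb d)) ∘ fwd (assoc (F c) (G 𝟙) (F d))
    ∘ (fwd (bimod_hb c) ⊠ idm (F d)).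
Proof. by rewrite -bimod_hb_tens_restrict [in RHS]compA. Qed.

Definition bimod_half_braiding : half_braiding F (G 𝟙) :=
  HalfBraiding bimod_hb_nat bimod_hb_tens bimod_hb_one.

End BimodHalfBraiding.

Section HalfBraidingAction.
Variables (k : fieldType) (C D : moncat k) (F : monfunctor C D).
Variables (X : lincat k) (A : laction D X) (z : D) (s : half_braiding F z).

Let T := bifunctor_r (lact A) z.
Let L := restrict_l F A.

Definition hb_lmod c x : iso (T (lact L c x)) (lact L c (T x)) :=
  iso_trans (iso_sym (lassoc A z (F c) x))
    (iso_trans (bifunctor_iso (lact A) (hb s c) (iso_refl x))
      (lassoc A (F c) z x)).

Fact hb_lmod_nat c c' x x' (f : Hom c c') (h : Hom x x') :
  fwd (hb_lmod c' x') ∘ fhom T (bhom (lact L) f h)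
  = bhom (lact L) f (fhom T h) ∘ fwd (hb_lmod c x).
Proof.
apply: (iso_epi (i := lassoc A z (F c) x)).
rewrite /= -!compA -lassoc_nat fwdK compm1 (compA (bwd _)) fwdK comp1m.
by rewrite !compA -lassoc_nat -!compA -!bhomM hb_nat comp1m compm1.
Qed.

Fact hb_lmod_unit x :
  fwd (lunit L (T x)) ∘ fwd (hb_lmod 𝟙 x) = fhom T (fwd (lunit L x)).
Proof.
apply: (iso_epi (i := lassoc A z (F 𝟙) x)).
rewrite /= -!compA fwdK compm1.
rewrite -(bhom1 (lact A) z x) (compA (bhom _ (bwd _) _)) -lassoc_nat -!compA.
rewrite (compA (fwd (lunit _ _))) lunit_lassoc -!bhomM !comp1m.
rewrite !compA hb_one bhomMr -compA -lassoc_nat compA ltriangle.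
by rewrite -bhomM comp1m.
Qed.

Fact hb_lmod_assoc c d x :
  fwd (lassoc L c d (T x)) ∘ fwd (hb_lmod (c ⊗ d) x)
  = bhom (lact L) (idm c) (fwd (hb_lmod d x))
    ∘ fwd (hb_lmod c (lact L d x))
    ∘ fhom T (fwd (lassoc L c d x)).
Proof.
apply: (iso_epi (i := lassoc A z (F (c ⊗ d)) x)).
pose i := bifunctor_iso (lact A)
  (bifunctor_iso tens (iso_refl z) (mon_two F c d)) (iso_refl x).
apply: (iso_epi (i := i)).
pose j := bifunctor_iso (lact A) (assoc z (F c) (F d)) (iso_refl x).
apply: (iso_epi (i := j)).
have P3 := lpentagon A (F c) (F d) z x.
have P2 := lpentagon A (F c) z (F d) x.
have P1 := lpentagon A z (F c) (F d) x.
have P1' := P1; rewrite -compA in P1'.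
have H := hb_tens s c d.
have -> : fwd (lassoc L c d (T x)) ∘ fwd (hb_lmod (c ⊗ d) x)
      ∘ fwd (lassoc A z (F (c ⊗ d)) x) ∘ fwd i ∘ fwd j
  = bhom (lact A) (idm (F c)) (fwd (lassoc A (F d) z x))
      ∘ fwd (lassoc A (F c) (F d ⊗ z) x)
      ∘ bhom (lact A) ((idm (F c) ⊠ fwd (hb s d))
          ∘ fwd (assoc (F c) z (F d)) ∘ (fwd (hb s c) ⊠ idm (F d))) (idm x).
  rewrite -H !bhomMl !compA P3 -!(compA (fwd (lassoc A _ _ (lact A z x)))).
  rewrite lassoc_nat bhom1 /= -!compA.
  by rewrite (compA (bwd _) (fwd _)) fwdK comp1m.
have -> : bhom (lact L) (idm c) (fwd (hb_lmod d x))
    ∘ fwd (hb_lmod c (lact L d x)) ∘ fhom T (fwd (lassoc L c d x))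
    ∘ fwd (lassoc A z (F (c ⊗ d)) x) ∘ fwd i ∘ fwd j
  = bhom (lact A) (idm (F c)) (fwd (hb_lmod d x))
    ∘ (fwd (lassoc A (F c) z (lact A (F d) x))
       ∘ bhom (lact A) (fwd (hb s c)) (idm (lact A (F d) x))
       ∘ fwd (lassoc A (z ⊗ F c) (F d) x)).
  rewrite /= fhom1 -!compA; do 3 congr (_ ∘ _).
  rewrite (compA (fwd (lassoc A z _ _)) (bhom _ _ _)) lassoc_nat.
  rewrite (bhomMr _ _ (fwd _) (bhom _ _ _)) -!compA.
  rewrite (compA (bhom _ _ (bhom _ (bwd _) _))) -!bhomMr -bhomMl fwdK bhom1.
  by rewrite bhom1 comp1m P1' compA fwdK comp1m.
have N := lassoc_nat A (fwd (hb s c)) (idm (F d)) (idm x).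
rewrite bhom1 in N.
rewrite -(compA (fwd (lassoc _ _ _ _))) -N (compA (fwd (lassoc _ _ _ _))) -P2.
have E : fwd (hb_lmod d x) ∘ fwd (lassoc A z (F d) x)
    = fwd (lassoc A (F d) z x) ∘ bhom (lact A) (fwd (hb s d)) (idm x).
  by rewrite /= -!compA fwdK compm1.
rewrite !bhomMl -!compA (compA (fwd (lassoc A _ _ x))) lassoc_nat.
by rewrite !compA -!bhomMr E.
Qed.

Definition half_braiding_lmod : lmodfunctor L L T :=
  LModFunctor hb_lmod_nat hb_lmod_assoc hb_lmod_unit.

End HalfBraidingAction.

(* [y] is a right dual of [x], and [x] is a left dual of [y]. *)
Record right_dual (k : fieldType) (C : moncat k) (x y : C) := RightDual {
  ev : Hom (y ⊗ x) 𝟙;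
  coev : Hom 𝟙 (x ⊗ y);
  zigzag_l :
    fwd (run x) ∘ (idm x ⊠ ev) ∘ fwd (assoc x y x) ∘ (coev ⊠ idm x)
      ∘ bwd (lun x) = idm x;
  zigzag_r :
    fwd (lun y) ∘ (ev ⊠ idm y) ∘ bwd (assoc y x y) ∘ (idm y ⊠ coev)
      ∘ bwd (run y) = idm y }.

Arguments ev {k C x y} d : rename.
Arguments coev {k C x y} d : rename.

Record finite_tensor_category (k : fieldType) := FiniteTensorCategory {
  ftc_mon :> moncat k;
  ftc_finite : finite_category ftc_mon;
  rdual : ftc_mon -> ftc_mon;
  rdualP : forall x, right_dual x (rdual x);
  ldual : ftc_mon -> ftc_mon;
  ldualP : forall x, right_dual (ldual x) x;
  ftc_end_one : bijective (fun a : k => a *: idm (𝟙 : ftc_mon)) }.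

Arguments rdualP {k C} x : rename.

Notation "x ^∨" := (rdual x) (at level 2, format "x ^∨") : cat_scope.

Record tensor_functor (k : fieldType) (C D : finite_tensor_category k) :=
  TensorFunctor {
  tens_mon :> monfunctor C D;
  tens_exact : exact_functor tens_mon }.

Definition perfect (k : fieldType) (C D : finite_tensor_category k)
    (F : tensor_functor C D) :=
  exists R : functor D C, inhabited (adjunction F R) /\ exact_functor R.

Section Duals.
Variables (k : fieldType) (C : finite_tensor_category k).
Implicit Types x y : C.

(* The comparison y → y' of two right duals of x, from the evaluation of the
   first and the coevaluation of the second. *)
Definition dual_compare x y y' (e : Hom (y ⊗ x) 𝟙) (c : Hom 𝟙 (x ⊗ y')) :
    Hom y y' :=
  fwd (lun y') ∘ (e ⊠ idm y') ∘ bwd (assoc y x y') ∘ (idm y ⊠ c)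
    ∘ bwd (run y).

Definition dual_map x y (f : Hom x y) : Hom (y^∨) (x^∨) :=
  dual_compare (ev (rdualP y) ∘ (idm (y^∨) ⊠ f)) (coev (rdualP x)).

Definition coev_tens x y : Hom 𝟙 (x ⊗ y ⊗ (y^∨ ⊗ x^∨)) :=
  bwd (assoc x y (y^∨ ⊗ x^∨)) ∘ (idm x ⊠ fwd (assoc y (y^∨) (x^∨)))
    ∘ (idm x ⊠ (coev (rdualP y) ⊠ idm (x^∨))) ∘ (idm x ⊠ bwd (lun (x^∨)))
    ∘ coev (rdualP x).

Definition dual_tens x y : Hom ((x ⊗ y)^∨) (y^∨ ⊗ x^∨) :=
  dual_compare (ev (rdualP (x ⊗ y))) (coev_tens x y).

End Duals.

Section FunctorDuals.
Variables (k : fieldType) (C D : finite_tensor_category k).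
Variable F : tensor_functor C D.

Definition mon_ev (c : C) : Hom (F (c^∨) ⊗ F c) 𝟙 :=
  bwd (mon_unit F) ∘ fhom F (ev (rdualP c)) ∘ fwd (mon_two F (c^∨) c).

Definition mon_coev (c : C) : Hom 𝟙 (F c ⊗ F (c^∨)) :=
  bwd (mon_two F c (c^∨)) ∘ fhom F (coev (rdualP c)) ∘ fwd (mon_unit F).

Definition mon_dual (c : C) : Hom (F (c^∨)) ((F c)^∨) :=
  dual_compare (mon_ev c) (coev (rdualP (F c))).

Definition mon_dual_inv (c : C) : Hom ((F c)^∨) (F (c^∨)) :=
  dual_compare (ev (rdualP (F c))) (mon_coev c).

Definition mon_double_dual (c : C) : Hom ((F c)^∨^∨) (F (c^∨^∨)) :=
  mon_dual_inv (c^∨) ∘ dual_map (mon_dual c).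

End FunctorDuals.

Record module_category (k : fieldType) (C : finite_tensor_category k) :=
  ModuleCategory {
  mod_cat :> lincat k;
  mod_finite : finite_category mod_cat;
  mod_act : laction C mod_cat;
  mod_exact_r : forall c, exact_functor (bifunctor_r (lact mod_act) c);
  mod_exact_l : forall m, exact_functor (bifunctor_l (lact mod_act) m) }.

Arguments mod_act {k C} M : rename.

Definition mact (k : fieldType) (C : finite_tensor_category k)
    (M : module_category C) : bifunctor C M M := lact (mod_act M).

Notation "c ▷ m" := (bob (mact _) c m)
  (at level 39, left associativity, format "c  ▷  m") : cat_scope.
Notation "f ▶ g" := (bhom (mact _) f g)
  (at level 39, left associativity, format "f  ▶  g") : cat_scope.

Definition massoc (k : fieldType) (C : finite_tensor_category k)
    (M : module_category C) (c d : C) (m : M) : iso ((c ⊗ d) ▷ m) (c ▷ (d ▷ m)) :=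
  lassoc (mod_act M) c d m.

Definition munit (k : fieldType) (C : finite_tensor_category k)
    (M : module_category C) (m : M) : iso ((𝟙 : C) ▷ m) m :=
  lunit (mod_act M) m.

Definition exact_module (k : fieldType) (C : finite_tensor_category k)
    (M : module_category C) :=
  forall (p : C) (m : M), projective p -> projective (p ▷ m).

Program Definition restrict_module (k : fieldType)
    (C D : finite_tensor_category k) (F : tensor_functor C D)
    (M : module_category D) : module_category C :=
  @ModuleCategory k C M (mod_finite M) (restrict_l F (mod_act M)) _ _.
Next Obligation.
by move=> x y z i q /(mod_exact_r (F c)); rewrite /= !fhom1.
Qed.
Next Obligation.
by move=> x y z i q /(tens_exact F)/(mod_exact_l m).
Qed.

Section Twisted.
Variables (k : fieldType) (C : finite_tensor_category k).
Variable N : module_category C.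

(* A functor with twisted structure morphisms T(c ▷ n) → c^∨∨ ▷ T(n).  Being
   an isomorphism of twisted module functors only involves these morphisms,
   whose coherence is a property of them. *)
Record twisted_functor := TwistedFunctor {
  tw_fun :> functor N N;
  tw_str : forall (c : C) (n : N), Hom (tw_fun (c ▷ n)) (c^∨^∨ ▷ tw_fun n) }.

Definition lmod_twisted (G : functor N N)
    (g : lmodfunctor (mod_act N) (mod_act N) G) (T : twisted_functor) :
    twisted_functor :=
  @TwistedFunctor (functor_comp G T)
    (fun c n => fwd (lmod g (c^∨^∨) (T n)) ∘ fhom G (tw_str T c n)).

Record twisted_iso (T T' : twisted_functor) := TwistedIso {
  twi : forall n, iso (T n) (T' n);
  twi_nat : forall n n' (f : Hom n n'),
    fwd (twi n') ∘ fhom T f = fhom T' f ∘ fwd (twi n);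
  twi_str : forall (c : C) (n : N),
    tw_str T' c n ∘ fwd (twi (c ▷ n))
    = (idm (c^∨^∨) ▶ fwd (twi n)) ∘ tw_str T c n }.

End Twisted.

Definition restrict_twisted (k : fieldType) (C D : finite_tensor_category k)
    (F : tensor_functor C D) (M : module_category D) (T : twisted_functor M) :
    twisted_functor (restrict_module F M) :=
  @TwistedFunctor k C (restrict_module F M) T
    (fun c m => (mon_double_dual F c ▶ idm (T m)) ∘ tw_str T (F c) m).

Record internal_hom (k : fieldType) (C : finite_tensor_category k)
    (M : module_category C) := InternalHom {
  ihom : M -> M -> C;
  ihom_ev : forall m n, Hom (ihom m n ▷ m) n;
  ihom_curry : forall m n (c : C), Hom (c ▷ m) n -> Hom c (ihom m n);
  ihom_curryK : forall m n (c : C) (f : Hom (c ▷ m) n),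
    ihom_ev m n ∘ (ihom_curry f ▶ idm m) = f;
  ihom_curry_uniq : forall m n (c : C) (g : Hom c (ihom m n)),
    ihom_curry (ihom_ev m n ∘ (g ▶ idm m)) = g }.

Section InternalHom.
Variables (k : fieldType) (C : finite_tensor_category k).
Variables (M : module_category C) (H : internal_hom M).
Implicit Types (c : C) (m n : M).

Definition ihom_mapr m n n' (f : Hom n n') : Hom (ihom H m n) (ihom H m n') :=
  ihom_curry H (f ∘ ihom_ev H m n).

Definition ihom_mapl m m' n (f : Hom m m') : Hom (ihom H m' n) (ihom H m n) :=
  ihom_curry H (ihom_ev H m' n ∘ (idm (ihom H m' n) ▶ f)).

Definition ihom_actr c m n : Hom (c ⊗ ihom H m n) (ihom H m (c ▷ n)) :=
  ihom_curry H ((idm c ▶ ihom_ev H m n) ∘ fwd (massoc c (ihom H m n) m)).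

Definition ihom_actl c m n : Hom (ihom H m n ⊗ c^∨) (ihom H (c ▷ m) n) :=
  ihom_curry H
    (ihom_ev H m n
     ∘ (idm (ihom H m n) ▶
          (fwd (munit m) ∘ (ev (rdualP c) ▶ idm m) ∘ bwd (massoc (c^∨) c m)))
     ∘ fwd (massoc (ihom H m n) (c^∨) (c ▷ m))).

(* The isomorphisms Hom(m,n)^∨ ≅ Hom(n, S m) are natural with respect to the
   action on n as well as to the morphisms of M (that is, they are isomorphisms
   of module functors in n): [serre_module].  The functor S is determined up
   to isomorphism by naturality in the morphisms alone, but without
   [serre_module] the isomorphisms are not determined by S, and the twisted
   structure [serre_str] obtained from them would depend on their choice. *)
Record relative_serre := RelativeSerre {
  serre :> functor M M;
  serre_iso : forall m n, iso ((ihom H m n)^∨) (ihom H n (serre m));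
  serre_natr : forall m n n' (f : Hom n n'),
    ihom_mapl (serre m) f ∘ fwd (serre_iso m n')
    = fwd (serre_iso m n) ∘ dual_map (ihom_mapr m f);
  serre_natl : forall m m' n (f : Hom m m'),
    ihom_mapr n (fhom serre f) ∘ fwd (serre_iso m n)
    = fwd (serre_iso m' n) ∘ dual_map (ihom_mapl n f);
  serre_module : forall c m n,
    fwd (serre_iso m (c ▷ n))
    = ihom_actl c n (serre m) ∘ (fwd (serre_iso m n) ⊠ idm (c^∨))
      ∘ dual_tens c (ihom H m n) ∘ dual_map (ihom_actr c m n) }.

Variable S : relative_serre.

(* Hom(n, S(c ▷ m)) ≅ Hom(c ▷ m, n)^∨ ≅ (Hom(m,n) ⊗ c^∨)^∨
   ≅ c^∨∨ ⊗ Hom(m,n)^∨ ≅ c^∨∨ ⊗ Hom(n, S m) ≅ Hom(n, c^∨∨ ▷ S m) *)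
Definition serre_chain c m n :
    Hom (ihom H n (S (c ▷ m))) (ihom H n (c^∨^∨ ▷ S m)) :=
  ihom_actr (c^∨^∨) n (S m)
    ∘ (idm (c^∨^∨) ⊠ fwd (serre_iso S m n))
    ∘ dual_tens (ihom H m n) (c^∨)
    ∘ dual_map (ihom_actl c m n)
    ∘ bwd (serre_iso S (c ▷ m) n).

(* The morphism S(c ▷ m) → c^∨∨ ▷ S(m) that induces [serre_chain] by the Yoneda
   lemma: the image of the identity under the chain for n = S(c ▷ m), where
   Hom(1, Hom(n,x)) is identified with Hom(n,x). *)
Definition serre_str c m : Hom (S (c ▷ m)) (c^∨^∨ ▷ S m) :=
  let n := S (c ▷ m) in
  ihom_ev H n (c^∨^∨ ▷ S m)
    ∘ ((serre_chain c m n ∘ ihom_curry H (fwd (munit n))) ▶ idm n)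
    ∘ bwd (munit n).

Definition serre_twisted : twisted_functor M := TwistedFunctor serre_str.

End InternalHom.

Section RelativeModular.
Variables (k : fieldType) (C D : finite_tensor_category k).
Variable F : tensor_functor C D.

(* A second right adjoint F^rra of [F], where [F] and its iterated right
   adjoints are functors of C-bimodule categories between C and the
   restriction of D along F. *)
Record double_right_adjoint := DoubleRightAdjoint {
  ra : bimodfunctor (restrict F (regular D)) (regular C);
  ra_adj : bimod_adjunction (mon_bimod F) ra;
  rra : bimodfunctor (regular C) (restrict F (regular D));
  rra_adj : bimod_adjunction ra rra }.

Variable R : double_right_adjoint.

Definition modular_object : D := rra R 𝟙.

Definition modular_half_braiding : half_braiding F modular_object :=
  bimod_half_braiding (rra R).

Variable M : module_category D.

Definition modular_action :
    functor (restrict_module F M) (restrict_module F M) :=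
  bifunctor_r (mact M) modular_object.

Definition modular_lmod :
    lmodfunctor (mod_act (restrict_module F M)) (mod_act (restrict_module F M))
      modular_action :=
  half_braiding_lmod (mod_act M) modular_half_braiding.

End RelativeModular.

(* Main.v *)
From mathcomp Require Import all_boot all_algebra.
Require Import Defs.

(** Call (T, t) a Serre trace on a module category M when t_m : Hom(m, T m) → 1
    makes T m represent n ↦ Hom(Hom(m, n), 1), dinaturally in m, and induces the
    twisted structure of T through Hom(c ▷ m, n) ≅ Hom(m, n) ⊗ c^∨.  Two twisted
    functors with Serre traces are uniquely isomorphic over their traces, and the
    relative Serre functor has one: the pairing ev ∘ (φ^-1 ⊗ id) on
    Hom(n, S m) ⊗ Hom(m, n), with φ : Hom(m, n)^∨ ≅ Hom(n, S m), is composition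
    followed by t_m.  A Serre trace over D gives one on χ ▷ T over C: trace
    F x ▷ m → χ ▷ T m to a morphism F x → χ = F^rra 1, and use the unit of
    F ⊣ F^ra and the counit of F^ra ⊣ F^rra to turn it into x → 1.  The half
    braiding of χ is exactly what compares the two module structures of F^rra
    in this last step. *)

Set Implicit Arguments.
Unset Strict Implicit.
Unset Printing Implicit Defensive.

Local Open Scope cat_scope.

Lemma iso_conj (k : fieldType) (C : lincat k) (a a' b b' : C) (i : iso a b)
    (i' : iso a' b') (f : Hom b' b) (g : Hom a' a) :
  f ∘ fwd i' = fwd i ∘ g -> bwd i ∘ f = g ∘ bwd i'.
Proof. by move/iso_swap_r=> ->; rewrite !compA fwdK comp1m. Qed.

(* Compositions defined below are sealed, since rewriting with [compA] would
   otherwise unfold and reassociate them. *)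
Fact seal : unit. Proof. by []. Qed.

(** * Evaluations and coevaluations acting on a module *)

Section DualAction.
Variables (k : fieldType) (C : moncat k) (X : lincat k) (A : laction C X).
Implicit Types (p q : X).

Lemma lassoc_natl c c' d p (f : Hom c c') :
  fwd (lassoc A c' d p) ∘ bhom (lact A) (f ⊠ idm d) (idm p)
  = bhom (lact A) f (idm (lact A d p)) ∘ fwd (lassoc A c d p).
Proof. by rewrite lassoc_nat bhom1. Qed.

Lemma lassoc_natm c d d' p (f : Hom d d') :
  fwd (lassoc A c d' p) ∘ bhom (lact A) (idm c ⊠ f) (idm p)
  = bhom (lact A) (idm c) (bhom (lact A) f (idm p)) ∘ fwd (lassoc A c d p).
Proof. by rewrite lassoc_nat. Qed.

Lemma lassoc_natr c d p q (h : Hom p q) :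
  fwd (lassoc A c d q) ∘ bhom (lact A) (idm (c ⊗ d)) h
  = bhom (lact A) (idm c) (bhom (lact A) (idm d) h) ∘ fwd (lassoc A c d p).
Proof. by rewrite -(bhom1 tens) lassoc_nat. Qed.

Lemma lassoc_bwd_nat c c' d d' p q (f : Hom c c') (g : Hom d d') (h : Hom p q) :
  bwd (lassoc A c' d' q) ∘ bhom (lact A) f (bhom (lact A) g h)
  = bhom (lact A) (f ⊠ g) h ∘ bwd (lassoc A c d p).
Proof.
apply: (iso_mono (i := lassoc A c' d' q)); rewrite !compA bwdK comp1m.
by rewrite lassoc_nat -compA bwdK compm1.
Qed.

Lemma lunit_bwd_nat p q (h : Hom p q) :
  bwd (lunit A q) ∘ h = bhom (lact A) (idm 𝟙) h ∘ bwd (lunit A p).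
Proof.
apply: (iso_mono (i := lunit A q)).
by rewrite !compA bwdK comp1m lunit_nat -compA bwdK compm1.
Qed.

(* On a module the axioms of duality become equations without associators,
   such as (x ▷ ev) ∘ coev = id. *)
Definition ev_act x y (e : Hom (y ⊗ x) 𝟙) p : Hom (lact A y (lact A x p)) p :=
  locked_with seal
    (fwd (lunit A p) ∘ bhom (lact A) e (idm p) ∘ bwd (lassoc A y x p)).

Definition coev_act x y (c : Hom 𝟙 (x ⊗ y)) p :
    Hom p (lact A x (lact A y p)) :=
  locked_with seal
    (fwd (lassoc A x y p) ∘ bhom (lact A) c (idm p) ∘ bwd (lunit A p)).

Lemma ev_actE x y (e : Hom (y ⊗ x) 𝟙) p :
  ev_act e p
  = fwd (lunit A p) ∘ bhom (lact A) e (idm p) ∘ bwd (lassoc A y x p).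
Proof. by rewrite /ev_act unlock. Qed.

Lemma coev_actE x y (c : Hom 𝟙 (x ⊗ y)) p :
  coev_act c p
  = fwd (lassoc A x y p) ∘ bhom (lact A) c (idm p) ∘ bwd (lunit A p).
Proof. by rewrite /coev_act unlock. Qed.

Lemma ev_act_nat x y (e : Hom (y ⊗ x) 𝟙) p q (h : Hom p q) :
  h ∘ ev_act e p
  = ev_act e q ∘ bhom (lact A) (idm y) (bhom (lact A) (idm x) h).
Proof.
rewrite !ev_actE -!compA lassoc_bwd_nat bhom1 !compA -lunit_nat; congr (_ ∘ _).
by rewrite -!compA -!bhomM !comp1m !compm1.
Qed.

Lemma coev_act_nat x y (c : Hom 𝟙 (x ⊗ y)) p q (h : Hom p q) :
  coev_act c q ∘ h
  = bhom (lact A) (idm x) (bhom (lact A) (idm y) h) ∘ coev_act c p.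
Proof.
rewrite !coev_actE -!compA lunit_bwd_nat !compA -lassoc_natr; congr (_ ∘ _).
by rewrite -!compA -!bhomM !comp1m !compm1.
Qed.

Lemma ev_act_comp x y y' (e : Hom (y ⊗ x) 𝟙) (f : Hom y' y) p :
  ev_act (e ∘ (f ⊠ idm x)) p
  = ev_act e p ∘ bhom (lact A) f (idm (lact A x p)).
Proof.
by rewrite !ev_actE -!compA -(bhom1 (lact A) x p) lassoc_bwd_nat bhomMl !compA.
Qed.

End DualAction.

(** * Zigzag composites and their action *)

Section DualActionTens.
Variables (k : fieldType) (C : moncat k).

Lemma run_nat_bwd (a b : C) (f : Hom a b) :
  bwd (run b) ∘ f = (f ⊠ idm 𝟙) ∘ bwd (run a).
Proof.
apply: (iso_mono (i := run b)).
by rewrite !compA bwdK comp1m run_nat -compA bwdK compm1.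
Qed.

(** The composite of the first zigzag identity, for independent objects. For a = h = x, the equation
    [mate c e = idm x] is that identity, and most lemmas on duals below assume only this half of
    duality. *)
Definition mate (a h w : C) (c : Hom 𝟙 (a ⊗ w)) (e : Hom (w ⊗ h) 𝟙) :
    Hom h a :=
  locked_with seal
    (fwd (run a) ∘ (idm a ⊠ e) ∘ fwd (assoc a w h) ∘ (c ⊠ idm h)
      ∘ bwd (lun h)).

Lemma mateE (a h w : C) (c : Hom 𝟙 (a ⊗ w)) (e : Hom (w ⊗ h) 𝟙) :
  mate c e
  = fwd (run a) ∘ (idm a ⊠ e) ∘ fwd (assoc a w h) ∘ (c ⊠ idm h) ∘ bwd (lun h).
Proof. by rewrite /mate unlock. Qed.

Let reg := regular_l C.

Section Tens.
Variables (X : lincat k) (A : laction C X).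

Lemma lassoc_bwd_pentagon a b c p :
  fwd (lassoc A (a ⊗ b) c p) ∘ bhom (lact A) (bwd (assoc a b c)) (idm p)
  = bwd (lassoc A a b (lact A c p))
    ∘ bhom (lact A) (idm a) (fwd (lassoc A b c p)) ∘ fwd (lassoc A a (b ⊗ c) p).
Proof.
rewrite -[RHS]compA; apply: iso_swap_l; rewrite compA -lpentagon.
by rewrite -!compA -bhomMl bwdK bhom1 compm1.
Qed.

(** Contractions in C, taken as a module over itself, act as contractions on [A]. With
    [coev_act_tens] this lets equations pass between C and its modules. *)
Lemma ev_act_tens x y (e : Hom (y ⊗ x) 𝟙) d p :
  bhom (lact A) (ev_act reg e d) (idm p)
  = ev_act A e (lact A d p) ∘ bhom (lact A) (idm y) (fwd (lassoc A x d p))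
    ∘ fwd (lassoc A y (x ⊗ d) p).
Proof.
rewrite !ev_actE /= !bhomMl -lunit_lassoc -!compA.
rewrite (compA (fwd (lassoc _ _ _ _)) (bhom _ (e ⊠ _) _)) lassoc_natl -!compA.
by rewrite lassoc_bwd_pentagon !compA.
Qed.

Lemma lun_bwd_act d p :
  fwd (lassoc A 𝟙 d p) ∘ bhom (lact A) (bwd (lun d)) (idm p)
  = bwd (lunit A (lact A d p)).
Proof.
apply: (iso_mono (i := lunit A _)).
by rewrite compA lunit_lassoc -bhomMl !bwdK bhom1.
Qed.

Lemma coev_act_tens x y (c : Hom 𝟙 (x ⊗ y)) d p :
  bhom (lact A) (idm x) (fwd (lassoc A y d p))
    ∘ fwd (lassoc A x (y ⊗ d) p) ∘ bhom (lact A) (coev_act reg c d) (idm p)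
  = coev_act A c (lact A d p).
Proof.
rewrite !coev_actE /= !bhomMl !compA lpentagon.
rewrite -!compA (compA (fwd (lassoc _ (x ⊗ y) _ _))) lassoc_natl -!compA.
by rewrite lun_bwd_act.
Qed.

Lemma mate_act a h w (c : Hom 𝟙 (a ⊗ w)) (e : Hom (w ⊗ h) 𝟙) p :
  bhom (lact A) (mate c e) (idm p)
  = bhom (lact A) (idm a) (ev_act A e p) ∘ coev_act A c (lact A h p).
Proof.
have -> : mate c e = fwd (run a) ∘ (idm a ⊠ e) ∘ coev_act reg c h.
  by rewrite mateE coev_actE /= !compA.
rewrite -coev_act_tens !bhomMl -ltriangle !compA; congr (_ ∘ _).
rewrite -!compA lassoc_natm !compA; congr (_ ∘ _).
by rewrite -!bhomMr ev_actE -compA fwdK compm1.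
Qed.

End Tens.

Lemma ev_act_one x y (e : Hom (y ⊗ x) 𝟙) :
  ev_act reg e 𝟙 = e ∘ (idm y ⊠ fwd (run x)).
Proof.
rewrite !ev_actE /= lun_one run_nat -compA; congr (_ ∘ _).
by rewrite -run_assoc -compA bwdK compm1.
Qed.

Lemma ev_act_regE x y (e : Hom (y ⊗ x) 𝟙) d :
  ev_act reg e d = fwd (lun d) ∘ (e ⊠ idm d) ∘ bwd (assoc y x d).
Proof. by rewrite ev_actE. Qed.

(** By naturality [e'] slides past the contraction with [e]; what is left inside is the zigzag of
    [c] and [e']. The long formula is [dual_compare e c], written out because that definition asks
    for a finite tensor category. *)
Lemma mate_ev x y y' (e : Hom (y ⊗ x) 𝟙) (c : Hom 𝟙 (x ⊗ y'))
    (e' : Hom (y' ⊗ x) 𝟙) :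
  mate c e' = idm x ->
  e' ∘ ((fwd (lun y') ∘ (e ⊠ idm y') ∘ bwd (assoc y x y') ∘ (idm y ⊠ c)
    ∘ bwd (run y)) ⊠ idm x) = e.
Proof.
move=> me; rewrite -ev_act_regE !bhomMl.
rewrite (ev_act_tens reg e) /=.
rewrite -!compA (compA e') (ev_act_nat reg) /= -!compA.
have -> : fwd (assoc y (x ⊗ y') x)
      ∘ (((idm y ⊠ c) ⊠ idm x) ∘ (bwd (run y) ⊠ idm x))
   = (idm y ⊠ (c ⊠ idm x)) ∘ (idm y ⊠ bwd (lun x)).
  rewrite compA assoc_nat -compA; congr (_ ∘ _).
  apply: (iso_mono (i := bifunctor_iso tens (iso_refl y) (lun x))).
  by rewrite /= compA triangle -bhomMl -bhomMr !bwdK !bhom1.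
rewrite ev_act_one -!compA -!bhomMr !compA.
by move: me; rewrite mateE => ->; rewrite bhom1 compm1.
Qed.

End DualActionTens.

(** * The dual of a tensor product *)

Section TensorOfDuals.
Variables (k : fieldType) (C : moncat k).
Implicit Types a w h x y z : C.

Let reg := regular_l C.

Definition ev_pair x x' y y' (e : Hom (x' ⊗ x) 𝟙) (e' : Hom (y' ⊗ y) 𝟙) :
    Hom (y' ⊗ x' ⊗ (x ⊗ y)) 𝟙 :=
  e' ∘ (idm y' ⊠ ev_act reg e y) ∘ fwd (assoc y' x' (x ⊗ y)).

Definition coev_pair x x' y y' (c : Hom 𝟙 (x ⊗ x')) (c' : Hom 𝟙 (y ⊗ y')) :
    Hom 𝟙 (x ⊗ y ⊗ (y' ⊗ x')) :=
  bwd (assoc x y (y' ⊗ x')) ∘ (idm x ⊠ coev_act reg c' x') ∘ c.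

Section Action.
Variables (X : lincat k) (A : laction C X).

Lemma zigzag_act x y (c : Hom 𝟙 (x ⊗ y)) (e : Hom (y ⊗ x) 𝟙) p :
  mate c e = idm x ->
  bhom (lact A) (idm x) (ev_act A e p) ∘ coev_act A c (lact A x p)
  = idm (lact A x p).
Proof. by rewrite -mate_act => ->; rewrite bhom1. Qed.

Lemma ev_act_bhom x y (e : Hom (y ⊗ x) 𝟙) p :
  fwd (lunit A p) ∘ bhom (lact A) e (idm p)
  = ev_act A e p ∘ fwd (lassoc A y x p).
Proof. by rewrite ev_actE -compA fwdK compm1. Qed.

Lemma coev_act_bhom x y (c : Hom 𝟙 (x ⊗ y)) p :
  fwd (lassoc A x y p) ∘ bhom (lact A) c (idm p)
  = coev_act A c p ∘ fwd (lunit A p).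
Proof. by rewrite coev_actE -compA fwdK compm1. Qed.

Lemma ev_act_pair x x' y y' (e : Hom (x' ⊗ x) 𝟙) (e' : Hom (y' ⊗ y) 𝟙) p :
  ev_act A (ev_pair e e') p
  = ev_act A e' p ∘ bhom (lact A) (idm y') (ev_act A e (lact A y p))
    ∘ bhom (lact A) (idm y')
        (bhom (lact A) (idm x') (fwd (lassoc A x y p)))
    ∘ fwd (lassoc A y' x' (lact A (x ⊗ y) p)).
Proof.
apply: (iso_epi (i := lassoc A (y' ⊗ x') (x ⊗ y) p)).
rewrite -ev_act_bhom /ev_pair !bhomMl !compA ev_act_bhom.
rewrite -!compA; congr (_ ∘ _).
rewrite compA lassoc_natm (ev_act_tens A e) -lpentagon !bhomMr.
by rewrite !compA.
Qed.

Lemma coev_act_pair x x' y y' (c : Hom 𝟙 (x ⊗ x')) (c' : Hom 𝟙 (y ⊗ y')) p :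
  bhom (lact A) (idm x) (bhom (lact A) (idm y) (fwd (lassoc A y' x' p)))
    ∘ fwd (lassoc A x y (lact A (y' ⊗ x') p)) ∘ coev_act A (coev_pair c c') p
  = bhom (lact A) (idm x) (coev_act A c' (lact A x' p)) ∘ coev_act A c p.
Proof.
apply: (iso_epi (i := lunit A p)).
rewrite -!compA -!coev_act_bhom /coev_pair !bhomMl.
rewrite -coev_act_tens !bhomMr.
rewrite !compA -(compA _ (fwd (lassoc A (x ⊗ y) _ _))) lassoc_bwd_pentagon.
rewrite !compA -(compA _ (fwd (lassoc A x y _))) bwdK compm1.
congr (_ ∘ _); rewrite -!compA; congr (_ ∘ _).
by rewrite -lassoc_natm !compA.
Qed.

(** Sliding [coev_act] of [c'] past the contraction with [e] separates the two zigzags: the one of y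
    cancels first, inside the action of x, and then the one of x. *)
Lemma mate_pair_act x x' y y' (c : Hom 𝟙 (x ⊗ x')) (e : Hom (x' ⊗ x) 𝟙)
    (c' : Hom 𝟙 (y ⊗ y')) (e' : Hom (y' ⊗ y) 𝟙) p :
  mate c e = idm x -> mate c' e' = idm y ->
  bhom (lact A) (mate (coev_pair c c') (ev_pair e e')) (idm p)
  = idm (lact A (x ⊗ y) p).
Proof.
move=> zx zy; rewrite mate_act; apply: (iso_mono (i := lassoc A x y p)).
rewrite compA lassoc_natr ev_act_pair !bhomMr compm1 -!compA.
have P := coev_act_pair c c' (lact A (x ⊗ y) p).
rewrite -compA in P; rewrite {}P.
rewrite (compA (bhom _ _ (bhom _ _ (bhom _ _ (bhom _ _ _))))).
rewrite -[X in _ ∘ (_ ∘ (X ∘ _)) = _]bhomMr -coev_act_nat bhomMr -!compA.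
rewrite -coev_act_nat.
rewrite (compA (bhom _ _ (bhom _ _ (bhom _ _ _)))).
rewrite -[X in _ ∘ (X ∘ _) = _]bhomMr -coev_act_nat bhomMr -!compA.
rewrite (compA (bhom _ _ (bhom _ _ _))) -bhomMr zigzag_act // bhom1 comp1m.
by rewrite compA zigzag_act // comp1m.
Qed.

End Action.

Lemma lun_nat_bwd x y (f : Hom x y) :
  bwd (lun y) ∘ f = (idm 𝟙 ⊠ f) ∘ bwd (lun x).
Proof. exact: (lunit_bwd_nat reg). Qed.

Lemma mate_natl a a' w h (c : Hom 𝟙 (a ⊗ w)) (e : Hom (w ⊗ h) 𝟙)
    (f : Hom a a') :
  mate ((f ⊠ idm w) ∘ c) e = f ∘ mate c e.
Proof.
rewrite !mateE !compA -run_nat bhomMl.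
congr (_ ∘ _); rewrite !compA; congr (_ ∘ _).
rewrite -!compA assoc_nat bhom1 !compA; congr (_ ∘ _).
by rewrite -!compA -bhom_lr -bhom_rl.
Qed.

Lemma mate_tens a w h q (c : Hom 𝟙 (a ⊗ w)) (e : Hom (w ⊗ h) 𝟙) :
  mate c e ⊠ idm q
  = (idm a ⊠ ev_act reg e q) ∘ fwd (assoc a w (h ⊗ q))
    ∘ (c ⊠ idm (h ⊗ q)) ∘ bwd (lun (h ⊗ q)).
Proof. by rewrite (mate_act reg) coev_actE !compA. Qed.

Lemma mate_pair x x' y y' (c : Hom 𝟙 (x ⊗ x')) (e : Hom (x' ⊗ x) 𝟙)
    (c' : Hom 𝟙 (y ⊗ y')) (e' : Hom (y' ⊗ y) 𝟙) :
  mate c e = idm x -> mate c' e' = idm y ->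
  mate (coev_pair c c') (ev_pair e e') = idm (x ⊗ y).
Proof.
move=> zx zy; apply: tens_id_r_inj.
by rewrite (mate_pair_act reg _ zx zy) bhom1.
Qed.

End TensorOfDuals.

(** * Dual maps characterized by evaluations *)

Section RightDuals.
Variables (k : fieldType) (C : finite_tensor_category k).
Implicit Types a x y z : C.

Let reg := regular_l C.

Lemma mate_right_dual x y (d : right_dual x y) : mate (coev d) (ev d) = idm x.
Proof. by rewrite mateE zigzag_l. Qed.

(** The maps [dual_map], [dual_tens], [mon_dual] and [mon_dual_inv] are instances of [dual_compare];
    they enter the sequel only through their effect on evaluations. *)
Lemma ev_dual_compare x y y' (e : Hom (y ⊗ x) 𝟙) (c : Hom 𝟙 (x ⊗ y'))
    (e' : Hom (y' ⊗ x) 𝟙) :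
  mate c e' = idm x -> e' ∘ (dual_compare e c ⊠ idm x) = e.
Proof. exact: mate_ev. Qed.

Lemma ev_dual_map x y (f : Hom x y) :
  ev (rdualP x) ∘ (dual_map f ⊠ idm x) = ev (rdualP y) ∘ (idm (y^∨) ⊠ f).
Proof. by rewrite ev_dual_compare // mate_right_dual. Qed.

Lemma ev_dual_tens x y :
  ev_pair (ev (rdualP x)) (ev (rdualP y)) ∘ (dual_tens x y ⊠ idm (x ⊗ y))
  = ev (rdualP (x ⊗ y)).
Proof.
apply: ev_dual_compare.
suff -> : coev_tens x y = coev_pair (coev (rdualP x)) (coev (rdualP y)).
  by apply: mate_pair; apply: mate_right_dual.
rewrite /coev_tens /coev_pair coev_actE /= !bhomMr -!compA; congr (_ ∘ _).
Qed.

(** Inserting [coev d] recovers f from its pairing with x; this rests on the second zigzag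
    identity. *)
Lemma ev_tens_inj x y z (d : right_dual x y) (f g : Hom z y) :
  ev d ∘ (f ⊠ idm x) = ev d ∘ (g ⊠ idm x) -> f = g.
Proof.
have E h : ev_act reg (ev d ∘ (h ⊠ idm x)) y ∘ (idm z ⊠ coev d)
    ∘ bwd (run z) = h.
  rewrite (ev_act_comp reg) /= -!compA (compA (h ⊠ _)).
  rewrite -bhom_lr bhom_rl -!compA -run_nat_bwd.
  by rewrite !compA ev_actE /= (zigzag_r d) comp1m.
by move=> e; rewrite -[f]E e E.
Qed.

End RightDuals.

(** * Duals under a monoidal functor *)

Section MonoidalDuals.
Variables (k : fieldType).

Lemma mate_mon (C D : moncat k) (F : monfunctor C D) (a w h : C)
    (c : Hom 𝟙 (a ⊗ w)) (e : Hom (w ⊗ h) 𝟙) :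
  mate (bwd (mon_two F a w) ∘ fhom F c ∘ fwd (mon_unit F))
    (bwd (mon_unit F) ∘ fhom F e ∘ fwd (mon_two F w h))
  = fhom F (mate c e).
Proof.
rewrite !mateE !fhomM; apply: (iso_epi (i := lun (F h))).
rewrite -2!compA fwdK compm1 -mon_lun -!compA.
rewrite (compA (fhom F (bwd (lun h)))) -fhomM fwdK fhom1 comp1m.
rewrite !bhomMl !compA; congr (_ ∘ _).
rewrite -(compA _ (fhom F (_ ⊠ _)) (fwd (mon_two F _ _))) -(fhom1 F) -mon_two_nat.
rewrite !compA; congr (_ ∘ _); last by rewrite fhom1.
have P := mon_assoc F a w h.
apply: (iso_epi (i := bifunctor_iso tens (mon_two F a w) (iso_refl (F h)))).
rewrite /= -3!compA -bhomMl fwdK !fhom1 bhom1 compm1.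
rewrite -2![in RHS]compA (compA (fhom F (fwd (assoc _ _ _)))) P !bhomMr -!compA.
rewrite (compA (fhom F (idm a ⊠ _))) -mon_two_nat fhom1.
by rewrite -mon_run_bwd -!compA (compA (bwd (mon_two _ _ _))) fwdK comp1m.
Qed.

Variables (C D : finite_tensor_category k) (F : tensor_functor C D).

Lemma mate_mon_dual (c : C) : mate (mon_coev F c) (mon_ev F c) = idm (F c).
Proof. by rewrite mate_mon mate_right_dual fhom1. Qed.

Lemma ev_mon_dual (c : C) :
  ev (rdualP (F c)) ∘ (mon_dual F c ⊠ idm (F c)) = mon_ev F c.
Proof. by rewrite ev_dual_compare // mate_right_dual. Qed.

(** The two factors of [mon_double_dual] are absorbed in turn by the evaluations. This equation is
    all that the comparison of twisted structures uses about the identification of double duals. *)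
Lemma ev_mon_double_dual (c : C) :
  mon_ev F (c^∨) ∘ (mon_double_dual F c ⊠ idm (F (c^∨)))
  = ev (rdualP ((F c)^∨)) ∘ (idm ((F c)^∨^∨) ⊠ mon_dual F c).
Proof.
rewrite /mon_double_dual bhomMl compA -ev_dual_map; congr (_ ∘ _).
by rewrite ev_dual_compare ?mate_mon_dual.
Qed.

End MonoidalDuals.

(** * Internal Homs with coefficients *)

Section InternalHomCoefficients.
Variables (k : fieldType) (C : finite_tensor_category k).
Variables (M : module_category C) (H : internal_hom M).
Implicit Types (a b c d x y : C) (m n : M).

Let reg := regular_l C.
Let A := mod_act M.

Lemma ihom_ext c m n (f g : Hom c (ihom H m n)) :
  ihom_ev H m n ∘ (f ▶ idm m) = ihom_ev H m n ∘ (g ▶ idm m) -> f = g.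
Proof. by move=> e; rewrite -[f]ihom_curry_uniq e ihom_curry_uniq. Qed.

Lemma ihom_ev_mapr m n n' (f : Hom n n') :
  ihom_ev H m n' ∘ (ihom_mapr H m f ▶ idm m) = f ∘ ihom_ev H m n.
Proof. exact: ihom_curryK. Qed.

Lemma ihom_ev_mapl m m' n (f : Hom m m') :
  ihom_ev H m n ∘ (ihom_mapl H n f ▶ idm m)
  = ihom_ev H m' n ∘ (idm (ihom H m' n) ▶ f).
Proof. exact: ihom_curryK. Qed.

Lemma ihom_ev_actr c m n :
  ihom_ev H m (c ▷ n) ∘ (ihom_actr H c m n ▶ idm m)
  = (idm c ▶ ihom_ev H m n) ∘ fwd (massoc c (ihom H m n) m).
Proof. exact: ihom_curryK. Qed.

Lemma ihom_ev_actl c m n :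
  ihom_ev H (c ▷ m) n ∘ (ihom_actl H c m n ▶ idm (c ▷ m))
  = ihom_ev H m n
    ∘ (idm (ihom H m n) ▶ ev_act A (ev (rdualP c)) m)
    ∘ fwd (massoc (ihom H m n) (c^∨) (c ▷ m)).
Proof. by rewrite ev_actE; exact: ihom_curryK. Qed.

(* The bijection Hom(x, a ⊗ Hom(m, n)) ≅ Hom(x ▷ m, a ▷ n). *)
Definition uncur a x m n (w : Hom x (a ⊗ ihom H m n)) : Hom (x ▷ m) (a ▷ n) :=
  locked_with seal
    ((idm a ▶ ihom_ev H m n) ∘ fwd (massoc a (ihom H m n) m) ∘ (w ▶ idm m)).

Lemma uncurE a x m n (w : Hom x (a ⊗ ihom H m n)) :
  uncur w
  = (idm a ▶ ihom_ev H m n) ∘ fwd (massoc a (ihom H m n) m) ∘ (w ▶ idm m).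
Proof. by rewrite /uncur unlock. Qed.

(** The inverse of [uncur]: the coefficient a is moved to the source as a^∨, the result is curried,
    and a is restored by its coevaluation. *)
Definition cur a x m n (f : Hom (x ▷ m) (a ▷ n)) : Hom x (a ⊗ ihom H m n) :=
  locked_with seal
    ((idm a ⊠ ihom_curry H (ev_act A (ev (rdualP a)) n ∘ (idm (a^∨) ▶ f)
                             ∘ fwd (massoc (a^∨) x m)))
      ∘ coev_act reg (coev (rdualP a)) x).

Lemma curE a x m n (f : Hom (x ▷ m) (a ▷ n)) :
  cur f
  = (idm a ⊠ ihom_curry H (ev_act A (ev (rdualP a)) n ∘ (idm (a^∨) ▶ f)
                             ∘ fwd (massoc (a^∨) x m)))
      ∘ coev_act reg (coev (rdualP a)) x.
Proof. by rewrite /cur unlock. Qed.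

Lemma uncur_actr a x m n (w : Hom x (a ⊗ ihom H m n)) :
  uncur w = ihom_ev H m (a ▷ n) ∘ ((ihom_actr H a m n ∘ w) ▶ idm m).
Proof. by rewrite uncurE bhomMl compA ihom_ev_actr. Qed.

Lemma uncur_natx a x y m n (w : Hom x (a ⊗ ihom H m n)) (g : Hom y x) :
  uncur (w ∘ g) = uncur w ∘ (g ▶ idm m).
Proof. by rewrite !uncurE bhomMl !compA. Qed.

Lemma uncur_nata a b x m n (w : Hom x (a ⊗ ihom H m n)) (g : Hom a b) :
  uncur ((g ⊠ idm _) ∘ w) = (g ▶ idm n) ∘ uncur w.
Proof.
rewrite !uncurE bhomMl !compA; congr (_ ∘ _).
rewrite -!compA /mact (lassoc_natl (mod_act M)) !compA; congr (_ ∘ _).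
by rewrite -!bhomM !comp1m !compm1.
Qed.

Lemma uncur_mapr a x m n n' (w : Hom x (a ⊗ ihom H m n)) (f : Hom n n') :
  uncur ((idm a ⊠ ihom_mapr H m f) ∘ w) = (idm a ▶ f) ∘ uncur w.
Proof.
rewrite !uncurE bhomMl !compA; congr (_ ∘ _).
rewrite -!compA /mact (lassoc_natm (mod_act M)) !compA; congr (_ ∘ _).
by rewrite -!bhomMr ihom_ev_mapr.
Qed.

Lemma uncur_mapl a x m m' n (w : Hom x (a ⊗ ihom H m' n)) (f : Hom m m') :
  uncur ((idm a ⊠ ihom_mapl H n f) ∘ w) = uncur w ∘ (idm x ▶ f).
Proof.
rewrite !uncurE bhomMl -!compA -(bhom_lr _ w f) (bhom_rl _ w f).
rewrite !compA; congr (_ ∘ _).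
rewrite -!compA /mact (lassoc_natm (mod_act M)) (lassoc_natr (mod_act M)).
by rewrite !compA -!bhomMr ihom_ev_mapl.
Qed.

Lemma uncur_act a x y m n (w : Hom x (a ⊗ ihom H m n)) :
  uncur (bwd (assoc y a _) ∘ (idm y ⊠ w))
  = bwd (massoc y a n) ∘ (idm y ▶ uncur w) ∘ fwd (massoc y x m).
Proof.
rewrite !uncurE -!compA; apply: iso_swap_l.
rewrite !compA (lassoc_natr A) -!compA bhomMl !bhomMr -!compA; congr (_ ∘ _).
rewrite -(lassoc_natm A) !compA; congr (_ ∘ _).
by rewrite -(compA (fwd _)) (lassoc_bwd_pentagon A) !compA bwdK comp1m.
Qed.

Lemma ihom_ev_transpose a x m n (w : Hom x (a ⊗ ihom H m n)) :
  ihom_ev H m n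
    ∘ ((ev_act reg (ev (rdualP a)) _ ∘ (idm (a^∨) ⊠ w)) ▶ idm m)
  = ev_act A (ev (rdualP a)) n ∘ (idm (a^∨) ▶ uncur w)
    ∘ fwd (massoc (a^∨) x m).
Proof.
rewrite bhomMl (ev_act_tens A) !compA (ev_act_nat A) uncurE !bhomMr -!compA.
by rewrite (lassoc_natm A).
Qed.

Lemma uncurK a x m n (w : Hom x (a ⊗ ihom H m n)) : cur (uncur w) = w.
Proof.
rewrite curE -ihom_ev_transpose ihom_curry_uniq bhomMr -compA.
rewrite -(coev_act_nat reg) compA (zigzag_act reg) ?mate_right_dual //.
exact: comp1m.
Qed.

Lemma curK a x m n (f : Hom (x ▷ m) (a ▷ n)) : uncur (cur f) = f.
Proof.
rewrite uncurE curE bhomMl -!compA (compA (fwd _)) (lassoc_natm A).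
rewrite !compA -bhomMr ihom_curryK !bhomMr -!compA.
rewrite [X in _ ∘ (_ ∘ X)]compA (coev_act_tens A) -(coev_act_nat A).
by rewrite compA (zigzag_act A) ?mate_right_dual // comp1m.
Qed.

Lemma uncur_inj a x m n (w w' : Hom x (a ⊗ ihom H m n)) :
  uncur w = uncur w' -> w = w'.
Proof. by move=> e; rewrite -[w]uncurK e uncurK. Qed.

(** Rigidity makes Hom(m, -) a module functor: the curried evaluation inverts [ihom_actr]. The other
    inverse identity is proved inside [actr_epi]. *)
Lemma actrK c m n :
  cur (ihom_ev H m (c ▷ n)) ∘ ihom_actr H c m n = idm _.
Proof.
apply: uncur_inj; rewrite uncur_natx curK ihom_ev_actr.
by rewrite uncurE bhom1 compm1.
Qed.

Lemma actr_epi c m n d (f g : Hom (ihom H m (c ▷ n)) d) :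
  f ∘ ihom_actr H c m n = g ∘ ihom_actr H c m n -> f = g.
Proof.
have E : ihom_actr H c m n ∘ cur (ihom_ev H m (c ▷ n)) = idm _.
  by apply: ihom_ext; rewrite -uncur_actr curK bhom1 compm1.
by move=> e; rewrite -[f]compm1 -E compA e -compA E compm1.
Qed.

End InternalHomCoefficients.

(** * Partial traces and Serre traces *)

Section Traces.
Variables (k : fieldType) (C : finite_tensor_category k).
Variables (M : module_category C) (H : internal_hom M).
Implicit Types (a b c d x y : C) (m n : M).

Let reg := regular_l C.
Let A := mod_act M.

(** The extension of the functional [t] to morphisms with coefficients: f becomes x → a ⊗ Hom(m, n),
    and [t] contracts the second factor. *)
Definition partial_trace a x m n (t : Hom (ihom H m n) 𝟙)
    (f : Hom (x ▷ m) (a ▷ n)) : Hom x a :=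
  locked_with seal (fwd (run a) ∘ (idm a ⊠ t) ∘ cur H f).

Lemma partial_trace_uncur a x m n (t : Hom (ihom H m n) 𝟙)
    (w : Hom x (a ⊗ ihom H m n)) :
  partial_trace t (uncur w) = fwd (run a) ∘ (idm a ⊠ t) ∘ w.
Proof. by rewrite /partial_trace unlock uncurK. Qed.

Lemma partial_trace_natx a x y m n (t : Hom (ihom H m n) 𝟙)
    (f : Hom (x ▷ m) (a ▷ n)) (g : Hom y x) :
  partial_trace t (f ∘ (g ▶ idm m)) = partial_trace t f ∘ g.
Proof. by rewrite -(curK H f) -uncur_natx !partial_trace_uncur compA. Qed.

Lemma partial_trace_nata a b x m n (t : Hom (ihom H m n) 𝟙)
    (f : Hom (x ▷ m) (a ▷ n)) (g : Hom a b) :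
  partial_trace t ((g ▶ idm n) ∘ f) = g ∘ partial_trace t f.
Proof.
rewrite -(curK H f) -uncur_nata !partial_trace_uncur !compA -run_nat.
by congr (_ ∘ _); rewrite -!compA -!bhomM !comp1m !compm1.
Qed.

Lemma partial_trace_mapr a x m n n' (t : Hom (ihom H m n') 𝟙)
    (f : Hom (x ▷ m) (a ▷ n)) (g : Hom n n') :
  partial_trace t ((idm a ▶ g) ∘ f) = partial_trace (t ∘ ihom_mapr H m g) f.
Proof.
by rewrite -(curK H f) -uncur_mapr !partial_trace_uncur bhomMr !compA.
Qed.

Lemma partial_trace_mapl a x m m' n (t : Hom (ihom H m n) 𝟙)
    (f : Hom (x ▷ m') (a ▷ n)) (g : Hom m m') :
  partial_trace t (f ∘ (idm x ▶ g)) = partial_trace (t ∘ ihom_mapl H n g) f.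
Proof.
by rewrite -(curK H f) -uncur_mapl !partial_trace_uncur bhomMr !compA.
Qed.

Lemma partial_trace_act a x y m n (t : Hom (ihom H m n) 𝟙)
    (f : Hom (x ▷ m) (a ▷ n)) :
  partial_trace t
    (bwd (massoc y a n) ∘ (idm y ▶ f) ∘ fwd (massoc y x m))
  = idm y ⊠ partial_trace t f.
Proof.
rewrite -(curK H f) -uncur_act !partial_trace_uncur !bhomMr -run_assoc.
rewrite !compA; congr (_ ∘ _); rewrite -!compA; congr (_ ∘ _).
rewrite -(bhom1 tens y a); apply: (iso_epi (i := assoc y a (ihom H m n))).
by rewrite -!compA fwdK compm1 assoc_nat.
Qed.

(** Transposing a reduces a trace with values in a to a functional on Hom(m, a^∨ ▷ n), to which the
    universal property without coefficients applies. *)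
Lemma ev_partial_trace a m n n' (t : Hom (ihom H m n') 𝟙)
    (g : Hom n (a ▷ n')) :
  ev (rdualP a) ∘ (idm (a^∨) ⊠ partial_trace t (g ∘ ihom_ev H m n))
  = t ∘ ihom_mapr H m (ev_act A (ev (rdualP a)) n' ∘ (idm (a^∨) ▶ g))
      ∘ ihom_actr H (a^∨) m n.
Proof.
rewrite -(curK H (g ∘ ihom_ev H m n)) partial_trace_uncur.
set w := cur H _; rewrite -[RHS]compA.
have -> : ihom_mapr H m (ev_act A (ev (rdualP a)) n' ∘ (idm (a^∨) ▶ g))
    ∘ ihom_actr H (a^∨) m n
  = ev_act reg (ev (rdualP a)) _ ∘ (idm (a^∨) ⊠ w).
  apply: ihom_ext; rewrite ihom_ev_transpose curK bhomMl compA ihom_ev_mapr.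
  by rewrite -compA ihom_ev_actr !bhomMr !compA.
by rewrite compA (ev_act_nat reg) ev_act_one !bhomMr !compA.
Qed.

Lemma transpose_inj a n n' (f g : Hom n (a ▷ n')) :
  ev_act A (ev (rdualP a)) n' ∘ (idm (a^∨) ▶ f)
  = ev_act A (ev (rdualP a)) n' ∘ (idm (a^∨) ▶ g) -> f = g.
Proof.
have E (h : Hom n (a ▷ n')) :
    (idm a ▶ (ev_act A (ev (rdualP a)) n' ∘ (idm (a^∨) ▶ h)))
    ∘ coev_act A (coev (rdualP a)) n = h.
  rewrite bhomMr -compA -(coev_act_nat A) compA (zigzag_act A) ?comp1m //.
  exact: mate_right_dual.
by move=> e; rewrite -[f]E e E.
Qed.

(* The object [T m] represents the functor n ↦ Hom(Hom(m, n), 1), with universal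
   element [st m]; [st_str] expresses that the twisted structure of [T] is
   induced by Hom(c ▷ m, n) ≅ Hom(m, n) ⊗ c^∨. *)
Record serre_trace (T : twisted_functor M) := SerreTrace {
  st : forall m, Hom (ihom H m (T m)) 𝟙;
  st_nat : forall m m' (f : Hom m m'),
    st m ∘ ihom_mapl H (T m) f = st m' ∘ ihom_mapr H m' (fhom T f);
  st_lift : forall m n, Hom (ihom H m n) 𝟙 -> Hom n (T m);
  st_liftK : forall m n (w : Hom (ihom H m n) 𝟙),
    st m ∘ ihom_mapr H m (st_lift w) = w;
  st_inj : forall m n (f g : Hom n (T m)),
    st m ∘ ihom_mapr H m f = st m ∘ ihom_mapr H m g -> f = g;
  st_str : forall c m,
    st (c ▷ m) ∘ ihom_actl H c m (T (c ▷ m))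
    = ev (rdualP (c^∨))
      ∘ (partial_trace (st m) (tw_str T c m ∘ ihom_ev H m (T (c ▷ m)))
           ⊠ idm (c^∨)) }.

Lemma transpose_tensK a x (w : Hom x a) :
  fwd (run a) ∘ (idm a ⊠ (ev (rdualP a) ∘ (idm (a^∨) ⊠ w)))
    ∘ coev_act reg (coev (rdualP a)) x = w.
Proof.
have -> : ev (rdualP a) ∘ (idm (a^∨) ⊠ w)
    = ev_act reg (ev (rdualP a)) 𝟙 ∘ (idm (a^∨) ⊠ (bwd (run a) ∘ w)).
  by rewrite ev_act_one -compA -bhomMr compA bwdK comp1m.
rewrite bhomMr -!compA -(coev_act_nat reg) (compA (bhom _ _ _)).
rewrite (zigzag_act reg) ?mate_right_dual // comp1m.
by rewrite compA bwdK comp1m.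
Qed.

Section OneTrace.
Variables (T : twisted_functor M) (t : serre_trace T).

(** Uniqueness in the universal property with coefficients: a ▷ T m represents n ↦ Hom(Hom(m, n),
    a). *)
Lemma partial_trace_inj a m n (f g : Hom n (a ▷ T m)) :
  partial_trace (st t m) (f ∘ ihom_ev H m n)
  = partial_trace (st t m) (g ∘ ihom_ev H m n) -> f = g.
Proof.
move=> e; apply: transpose_inj; apply: (st_inj (s := t)).
by apply: actr_epi; rewrite -!ev_partial_trace e.
Qed.

(** Existence in the same property: [w] is transposed to a functional on Hom(m, a^∨ ▷ n), lifted by
    [st_lift], and transposed back. *)
Definition coef_lift a m n (w : Hom (ihom H m n) a) : Hom n (a ▷ T m) :=
  (idm a ▶ st_lift t (ev (rdualP a) ∘ (idm (a^∨) ⊠ w)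
                        ∘ cur H (ihom_ev H m (a^∨ ▷ n))))
  ∘ coev_act A (coev (rdualP a)) n.

Lemma coef_liftK a m n (w : Hom (ihom H m n) a) :
  partial_trace (st t m) (coef_lift w ∘ ihom_ev H m n) = w.
Proof.
rewrite /coef_lift; set f := st_lift t _.
rewrite -compA (coev_act_nat A) compA -bhomMr.
(* The map is rewritten as an evaluation on Hom(m, T m), so that the whole morphism becomes an
   [uncur] and its trace can be read off. *)
have -> : f ∘ (idm (a^∨) ▶ ihom_ev H m n)
  = ihom_ev H m (T m) ∘ ((ihom_mapr H m f ∘ ihom_actr H (a^∨) m n) ▶ idm m)
    ∘ bwd (massoc (a^∨) (ihom H m n) m).
  rewrite bhomMl compA ihom_ev_mapr -!compA.
  by rewrite (compA (ihom_ev _ _ _)) ihom_ev_actr -compA bwdK compm1.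
set g := ihom_mapr H m f ∘ _.
rewrite !bhomMr -!compA -(coev_act_tens A) -!compA.
rewrite [X in _ ∘ (_ ∘ X)]compA -bhomMr fwdK bhom1 comp1m.
rewrite (compA (bhom _ _ (bhom _ _ _))) -(lassoc_natm A) -compA -bhomMl.
rewrite compA -uncurE partial_trace_uncur compA -2!compA (compA _ (idm a ⊠ g)).
rewrite -bhomMr /g (compA (st t m)) /f st_liftK -(compA _ (cur _ _)) actrK compm1.
by rewrite compA transpose_tensK.
Qed.

End OneTrace.

Lemma ihom_mapr_comp m n n' n'' (g : Hom n' n'') (f : Hom n n') :
  ihom_mapr H m (g ∘ f) = ihom_mapr H m g ∘ ihom_mapr H m f.
Proof.
apply: ihom_ext; rewrite ihom_ev_mapr bhomMl compA ihom_ev_mapr.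
by rewrite -[RHS]compA ihom_ev_mapr compA.
Qed.

Lemma ihom_mapr1 m n : ihom_mapr H m (idm n) = idm (ihom H m n).
Proof. by apply: ihom_ext; rewrite ihom_ev_mapr bhom1 comp1m compm1. Qed.

Lemma ihom_maplr m m' n n' (f : Hom m m') (g : Hom n n') :
  ihom_mapl H n' f ∘ ihom_mapr H m' g = ihom_mapr H m g ∘ ihom_mapl H n f.
Proof.
apply: ihom_ext; rewrite !bhomMl !compA ihom_ev_mapr ihom_ev_mapl.
rewrite -!compA ihom_ev_mapl -bhomM comp1m compm1 bhom_lr compA.
by rewrite ihom_ev_mapr -compA.
Qed.

Lemma ihom_actl_mapr c m n n' (g : Hom n n') :
  ihom_actl H c m n' ∘ (ihom_mapr H m g ⊠ idm (c^∨))
  = ihom_mapr H (c ▷ m) g ∘ ihom_actl H c m n.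
Proof.
apply: ihom_ext; rewrite !bhomMl !compA ihom_ev_mapr ihom_ev_actl.
rewrite -!compA (lassoc_natl A) ihom_ev_actl !compA; congr (_ ∘ _).
rewrite -ihom_ev_mapr -!compA; congr (_ ∘ _).
by rewrite -!bhomM !comp1m !compm1.
Qed.

Section Comparison.
Variables (T T' : twisted_functor M) (t : serre_trace T) (t' : serre_trace T').

Definition trace_compare m : Hom (T m) (T' m) := st_lift t' (st t m).

Lemma st_trace_compare m :
  st t' m ∘ ihom_mapr H m (trace_compare m) = st t m.
Proof. exact: st_liftK. Qed.

Lemma trace_compare_nat m m' (f : Hom m m') :
  trace_compare m' ∘ fhom T f = fhom T' f ∘ trace_compare m.
Proof.
apply: (st_inj (s := t')); rewrite !ihom_mapr_comp !compA st_trace_compare.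
by rewrite -!st_nat -compA ihom_maplr compA st_trace_compare.
Qed.

(** Both sides are tested by tracing with [t'] and pairing with c^∨; [st_str] then turns each
    twisted structure into [ihom_actl], which commutes with [ihom_mapr]. *)
Lemma trace_compare_str c m :
  tw_str T' c m ∘ trace_compare (c ▷ m)
  = (idm (c^∨^∨) ▶ trace_compare m) ∘ tw_str T c m.
Proof.
apply: (partial_trace_inj (t := t')).
apply: (@ev_tens_inj _ _ _ _ _ (rdualP (c^∨))).
rewrite -[in RHS]compA partial_trace_mapr st_trace_compare -st_str.
rewrite -compA -ihom_ev_mapr compA partial_trace_natx bhomMl compA -st_str.
by rewrite -compA ihom_actl_mapr compA st_trace_compare.
Qed.

End Comparison.

Lemma trace_compareK T T' (t : serre_trace T) (t' : serre_trace T') m :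
  trace_compare t' t m ∘ trace_compare t t' m = idm (T m).
Proof.
apply: (st_inj (s := t)); rewrite ihom_mapr_comp compA !st_trace_compare.
by rewrite ihom_mapr1 compm1.
Qed.

Definition serre_trace_iso T T' (t : serre_trace T) (t' : serre_trace T') :
    twisted_iso T T' :=
  @TwistedIso k C M T T'
    (fun m => Iso (trace_compareK t t' m) (trace_compareK t' t m))
    (fun m m' f => trace_compare_nat t t' f) (trace_compare_str t t').

End Traces.

(** The axiom [st_str] with coefficients: f is [uncur] of some w : x → a ⊗ Hom(m, T(c ▷ m)), which
    reduces the claim to [st_str] in the second factor. *)
Lemma partial_trace_str (k : fieldType) (C : finite_tensor_category k)
    (M : module_category C) (H : internal_hom M) (T : twisted_functor M)
    (t : serre_trace H T) (a x c : C) (m : M)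
    (f : Hom (x ▷ m) (a ▷ T (c ▷ m))) :
  partial_trace (st t (c ▷ m))
    (f ∘ (idm x ▶ ev_act (mod_act M) (ev (rdualP c)) m)
       ∘ fwd (massoc x (c^∨) (c ▷ m)))
  = fwd (run a) ∘ (idm a ⊠ ev (rdualP (c^∨))) ∘ fwd (assoc a (c^∨^∨) (c^∨))
    ∘ (partial_trace (st t m)
         (bwd (massoc a (c^∨^∨) (T m)) ∘ (idm a ▶ tw_str T c m) ∘ f)
         ⊠ idm (c^∨)).
Proof.
set A := mod_act M; rewrite -(curK H f); move: (cur H f) => w {f}.
set h := ihom H m (T (c ▷ m)).
have -> : uncur w ∘ (idm x ▶ ev_act A (ev (rdualP c)) m)
    ∘ fwd (massoc x (c^∨) (c ▷ m))
  = uncur ((idm a ⊠ ihom_actl H c m (T (c ▷ m))) ∘ fwd (assoc a h (c^∨))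
           ∘ (w ⊠ idm (c^∨))).
  rewrite [RHS]uncurE !bhomMl !compA -(compA _ (fwd (massoc _ _ _))).
  rewrite (lassoc_natm A) compA -bhomMr ihom_ev_actl !bhomMr.
  have P := lpentagon A a h (c^∨) (c ▷ m); rewrite -compA in P.
  rewrite -!compA (compA (fwd (lassoc _ _ _ _)) (bhom _ (fwd _) _)).
  rewrite (compA (bhom _ _ (fwd _))) P -!compA.
  rewrite (lassoc_natl A) uncurE -!compA; congr (_ ∘ _).
  rewrite (compA (bhom _ _ (bhom _ _ _))) -(lassoc_natr A) -compA.
  by congr (_ ∘ _); rewrite !compA -bhom_lr -bhom_rl.
have -> : bwd (massoc a (c^∨^∨) (T m)) ∘ (idm a ▶ tw_str T c m) ∘ uncur w
  = bwd (massoc a (c^∨^∨) (T m)) ∘ (idm a ▶ (tw_str T c m ∘ ihom_ev H m _))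
    ∘ fwd (massoc a h m) ∘ (w ▶ idm m).
  by rewrite uncurE bhomMr !compA.
rewrite partial_trace_natx partial_trace_act partial_trace_uncur bhomMl.
rewrite !compA -(compA _ (idm a ⊠ st t _)) -bhomMr st_str bhomMr !compA.
congr (_ ∘ _); rewrite -!compA; congr (_ ∘ (_ ∘ _)).
by rewrite assoc_nat.
Qed.

(** * The Serre trace of the relative Serre functor *)

Section SerreTrace.
Variables (k : fieldType) (C : finite_tensor_category k).
Variables (M : module_category C) (H : internal_hom M) (S : relative_serre H).
Implicit Types (a b c d x y : C) (m n : M).

Let reg := regular_l C.
Let A := mod_act M.

Definition name m n (f : Hom m n) : Hom 𝟙 (ihom H m n) :=
  ihom_curry H (f ∘ fwd (munit m)).

Lemma ihom_ev_name m n (f : Hom m n) :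
  ihom_ev H m n ∘ (name f ▶ idm m) = f ∘ fwd (munit m).
Proof. exact: ihom_curryK. Qed.

Lemma name_mapr m n n' (f : Hom m n) (g : Hom n n') :
  ihom_mapr H m g ∘ name f = name (g ∘ f).
Proof.
apply: ihom_ext; rewrite ihom_ev_name bhomMl compA ihom_ev_mapr.
by rewrite -compA ihom_ev_name compA.
Qed.

Lemma name_mapl m m' n (f : Hom m' n) (g : Hom m m') :
  ihom_mapl H n g ∘ name f = name (f ∘ g).
Proof.
apply: ihom_ext; rewrite ihom_ev_name bhomMl compA ihom_ev_mapl.
rewrite -compA -bhom_rl bhom_lr compA ihom_ev_name -!compA.
by rewrite (lunit_nat A).
Qed.

Lemma ev_munit_name m n (w : Hom 𝟙 (ihom H m n)) :
  name (ihom_ev H m n ∘ (w ▶ idm m) ∘ bwd (munit m)) = w.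
Proof. by apply: ihom_ext; rewrite ihom_ev_name -compA fwdK compm1. Qed.

Lemma name_inj m n (f g : Hom m n) : name f = name g -> f = g.
Proof.
move=> e; apply: (iso_epi (i := munit m)).
by rewrite -!ihom_ev_name e.
Qed.

Definition serre_pairing m n : Hom (ihom H n (S m) ⊗ ihom H m n) 𝟙 :=
  locked_with seal
    (ev (rdualP (ihom H m n)) ∘ (bwd (serre_iso S m n) ⊠ idm (ihom H m n))).

Lemma serre_pairingE m n :
  serre_pairing m n
  = ev (rdualP (ihom H m n)) ∘ (bwd (serre_iso S m n) ⊠ idm (ihom H m n)).
Proof. by rewrite /serre_pairing unlock. Qed.

Lemma serre_pairing_iso x m n (f : Hom x ((ihom H m n)^∨)) :
  serre_pairing m n ∘ ((fwd (serre_iso S m n) ∘ f) ⊠ idm _)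
  = ev (rdualP (ihom H m n)) ∘ (f ⊠ idm _).
Proof. by rewrite serre_pairingE -compA -bhomMl compA fwdK comp1m. Qed.

Lemma serre_pairing_natr m n n' (f : Hom n n') :
  serre_pairing m n' ∘ (idm _ ⊠ ihom_mapr H m f)
  = serre_pairing m n ∘ (ihom_mapl H (S m) f ⊠ idm _).
Proof.
have E : bwd (serre_iso S m n) ∘ ihom_mapl H (S m) f
    = dual_map (ihom_mapr H m f) ∘ bwd (serre_iso S m n').
  exact/iso_conj/serre_natr.
rewrite !serre_pairingE -!compA -bhomM comp1m compm1 -bhomMl E bhomMl !compA.
by rewrite ev_dual_map -compA -bhomM comp1m compm1.
Qed.

Lemma serre_pairing_natl m m' n (f : Hom m m') :
  serre_pairing m' n ∘ (ihom_mapr H n (fhom S f) ⊠ idm _)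
  = serre_pairing m n ∘ (idm _ ⊠ ihom_mapl H n f).
Proof.
have E : bwd (serre_iso S m' n) ∘ ihom_mapr H n (fhom S f)
    = dual_map (ihom_mapl H n f) ∘ bwd (serre_iso S m n).
  exact/iso_conj/serre_natl.
rewrite !serre_pairingE -!compA -bhomMl E bhomMl !compA ev_dual_map.
by rewrite -!compA -bhom_lr -bhom_rl.
Qed.

Definition serre_st m : Hom (ihom H m (S m)) 𝟙 :=
  locked_with seal
    (serre_pairing m (S m) ∘ (name (idm (S m)) ⊠ idm _) ∘ bwd (lun _)).

Lemma serre_stE m :
  serre_st m
  = serre_pairing m (S m) ∘ (name (idm (S m)) ⊠ idm _) ∘ bwd (lun _).
Proof. by rewrite /serre_st unlock. Qed.

(** Naturality of the pairing in n moves f onto the identity of S m. *)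
Lemma serre_st_mapr m n (f : Hom n (S m)) :
  serre_st m ∘ ihom_mapr H m f
  = serre_pairing m n ∘ (name f ⊠ idm _) ∘ bwd (lun _).
Proof.
rewrite serre_stE -!compA lun_nat_bwd !compA; congr (_ ∘ _).
rewrite -!compA -bhom_lr bhom_rl compA serre_pairing_natr -compA -bhomMl.
by rewrite name_mapl comp1m.
Qed.

Lemma serre_st_nat m m' (f : Hom m m') :
  serre_st m ∘ ihom_mapl H (S m) f = serre_st m' ∘ ihom_mapr H m' (fhom S f).
Proof.
rewrite serre_st_mapr -[fhom S f]compm1 -name_mapr bhomMl !compA.
rewrite serre_pairing_natl serre_stE -!compA lun_nat_bwd.
congr (_ ∘ _); rewrite !compA; congr (_ ∘ _).
by rewrite -bhom_lr -bhom_rl.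
Qed.

(** A functional on Hom(m, n) is a point of Hom(m, n)^∨, hence by the Serre isomorphism a point of
    Hom(n, S m). *)
Definition serre_lift m n (w : Hom (ihom H m n) 𝟙) : Hom n (S m) :=
  ihom_ev H n (S m)
  ∘ ((fwd (serre_iso S m n)
       ∘ dual_compare (w ∘ fwd (lun _)) (coev (rdualP (ihom H m n)))) ▶ idm n)
  ∘ bwd (munit n).

Lemma serre_liftK m n (w : Hom (ihom H m n) 𝟙) :
  serre_st m ∘ ihom_mapr H m (serre_lift w) = w.
Proof.
rewrite serre_st_mapr ev_munit_name serre_pairing_iso ev_dual_compare.
  by rewrite -compA bwdK compm1.
exact: mate_right_dual.
Qed.

Lemma serre_st_inj m n (f g : Hom n (S m)) :
  serre_st m ∘ ihom_mapr H m f = serre_st m ∘ ihom_mapr H m g -> f = g.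
Proof.
rewrite !serre_st_mapr => /(iso_epi (i := iso_sym (lun _))).
rewrite !serre_pairingE -!compA -!bhomMl => /ev_tens_inj.
by move/(iso_mono (i := iso_sym (serre_iso S m n)))/name_inj.
Qed.

(* The module compatibility of the Serre isomorphisms forces the pairing to be
   composition followed by the trace. *)
Lemma serre_pairing_comp m n :
  serre_pairing m n
  = serre_st m ∘ (ihom_mapr H m (ihom_ev H n (S m))
                    ∘ ihom_actr H (ihom H n (S m)) m n).
Proof.
set y := ihom H n (S m); set h := ihom H m n.
set q := ihom_ev H n (S m).
rewrite compA serre_st_mapr.
(* The factorization in [serre_module] sends the point [r0] of Hom(m, n)^∨ ⊗ y^∨ to the name of
   q. *)
have [r0 Er0 Er] : exists2 r0 : Hom 𝟙 (h^∨ ⊗ y^∨),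
    ev_pair (ev (rdualP y)) (ev (rdualP h)) ∘ (r0 ⊠ idm (y ⊗ h))
    = serre_pairing m (y ▷ n) ∘ (name q ⊠ ihom_actr H y m n)
  & name q = ihom_actl H y n (S m)
    ∘ ((fwd (serre_iso S m n) ⊠ idm (y^∨)) ∘ r0).
  pose r := bwd (serre_iso S m (y ▷ n)) ∘ name q.
  exists (dual_tens y h ∘ (dual_map (ihom_actr H y m n) ∘ r)).
    rewrite bhomMl compA ev_dual_tens bhomMl compA.
    rewrite ev_dual_map serre_pairingE -compA -bhom_rl -compA -bhomM.
    by rewrite comp1m.
  have -> : name q = fwd (serre_iso S m (y ▷ n)) ∘ r.
    by rewrite /r compA bwdK comp1m.
  by rewrite serre_module -3!compA.
(* The map y → Hom(m, n)^∨ encoded by [r0] is inverse to the Serre isomorphism, because q is the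
   evaluation on y and so curries to the identity. *)
have Em : fwd (serre_iso S m n) ∘ mate r0 (ev (rdualP y)) = idm y.
  rewrite -mate_natl; apply: ihom_ext; rewrite (mate_act A).
  rewrite coev_actE !compA -ihom_ev_actl -(compA _ _ (bhom _ _ _)) -bhomMl.
  rewrite -Er ihom_ev_name -compA bwdK compm1.
  by rewrite /q bhom1 compm1.
have -> : serre_pairing m n = ev (rdualP h) ∘ (mate r0 (ev (rdualP y)) ⊠ idm h).
  by rewrite -serre_pairing_iso Em bhom1 compm1.
rewrite mate_tens !compA.
rewrite -/(ev_pair _ _) Er0 bhom_lr -!compA; congr (_ ∘ (_ ∘ _)).
by rewrite lun_nat_bwd.
Qed.

(** A point z of c^∨∨ ⊗ Hom(n, S m) represents [serre_str]. Tracing after it gives the pairing with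
    z, by [serre_pairing_comp], and the dual of [ihom_actl] inside [serre_chain] becomes [ihom_actl]
    on the other side of the pairing. *)
Lemma serre_st_str c m :
  serre_st (c ▷ m) ∘ ihom_actl H c m (S (c ▷ m))
  = ev (rdualP (c^∨))
    ∘ (partial_trace (serre_st m) (serre_str S c m ∘ ihom_ev H m (S (c ▷ m)))
         ⊠ idm (c^∨)).
Proof.
set n := S (c ▷ m); set h := ihom H m n; set w := ihom H n (S m).
set a := c^∨^∨.
have [z Es Ez] : exists2 z : Hom 𝟙 (a ⊗ w),
    serre_str S c m = uncur z ∘ bwd (munit n)
  & ev_pair (ev (rdualP h)) (ev (rdualP (c^∨)))
      ∘ (((idm a ⊠ bwd (serre_iso S m n)) ∘ z) ⊠ idm (h ⊗ c^∨))
    = serre_pairing (c ▷ m) n ∘ (name (idm n) ⊠ ihom_actl H c m n).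
  (* The image of the identity of n along [serre_chain], stopped before Hom(m, n)^∨ is replaced by
     Hom(n, S m). *)
  pose z0 : Hom 𝟙 (a ⊗ h^∨) := dual_tens h (c^∨)
    ∘ (dual_map (ihom_actl H c m n)
         ∘ (bwd (serre_iso S (c ▷ m) n) ∘ name (idm n))).
  exists ((idm a ⊠ fwd (serre_iso S m n)) ∘ z0).
    rewrite /serre_str; congr (_ ∘ _); rewrite uncur_actr; congr (_ ∘ _).
    congr (bhom _ _ _); rewrite /serre_chain /z0 /name comp1m.
    by rewrite -4!compA.
  rewrite (compA (idm a ⊠ _)) -bhomMr fwdK bhom1 comp1m /z0.
  rewrite bhomMl (compA (ev_pair _ _)) ev_dual_tens bhomMl compA.
  rewrite ev_dual_map serre_pairingE -compA -bhom_rl -compA -bhomM.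
  by rewrite comp1m.
have -> : serre_str S c m ∘ ihom_ev H m n
  = uncur ((idm a ⊠ (ihom_mapr H m (ihom_ev H n (S m)) ∘ ihom_actr H w m n))
      ∘ coev_act reg z h).
  rewrite Es [RHS]uncurE bhomMl -[RHS]compA (compA (fwd (massoc _ _ _))).
  rewrite (lassoc_natm A) !compA -bhomMr.
  rewrite bhomMl !compA ihom_ev_mapr -(compA (ihom_ev _ _ _)) ihom_ev_actr.
  rewrite !bhomMr -!compA.
  have Z := coev_act_tens A z h m; rewrite -compA in Z; rewrite Z.
  rewrite -(coev_act_nat A) coev_actE uncurE -!compA.
  by [].
rewrite partial_trace_uncur [X in _ ∘ (X ⊠ _)]compA -[X in (X ∘ _) ⊠ _]compA.
rewrite -bhomMr -serre_pairing_comp.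
have -> : fwd (run a) ∘ (idm a ⊠ serre_pairing m n) ∘ coev_act reg z h
    = mate z (serre_pairing m n).
  by rewrite mateE coev_actE !compA.
rewrite mate_tens serre_pairingE (ev_act_comp reg) bhomMr -!compA.
rewrite /= (compA (idm a ⊠ (_ ⊠ _))) -(bhom1 tens h) -assoc_nat !(bhom1 tens h).
rewrite -compA (compA ((_ ⊠ _) ⊠ _)) -bhomMl !compA -/(ev_pair _ _) Ez.
rewrite serre_stE [in RHS]bhom_lr -!compA; congr (_ ∘ (_ ∘ _)).
by rewrite lun_nat_bwd.
Qed.

Definition serre_twisted_trace : serre_trace H (serre_twisted S) :=
  @SerreTrace k C M H (serre_twisted S) serre_st serre_st_nat serre_lift
    serre_liftK serre_st_inj serre_st_str.

End SerreTrace.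

(** * Descent along the double right adjoint *)

Section DoubleAdjoint.
Variables (k : fieldType) (C D : finite_tensor_category k).
Variables (F : tensor_functor C D) (R : double_right_adjoint F).
Implicit Types (a x y : C) (d : D).

Let G := rra R.
Let η := adj_unit (ra_adj R).
Let ε := adj_counit (ra_adj R).
Let η' := adj_unit (rra_adj R).
Let ε' := adj_counit (rra_adj R).

(* The unit of F ⊣ F^ra and the counit of F^ra ⊣ F^rra turn F x → F^rra a into
   x → a. *)
Definition descend x a (u : Hom (F x) (G a)) : Hom x a :=
  locked_with seal (ε' a ∘ fhom (ra R) u ∘ η x).

Lemma descendE x a (u : Hom (F x) (G a)) :
  descend u = ε' a ∘ fhom (ra R) u ∘ η x.
Proof. by rewrite /descend unlock. Qed.

Lemma descend_natl x y a (u : Hom (F x) (G a)) (g : Hom y x) :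
  descend (u ∘ fhom F g) = descend u ∘ g.
Proof.
by rewrite !descendE fhomM -!compA -(adj_unit_nat (ra_adj R)).
Qed.

Lemma descend_natr x a b (u : Hom (F x) (G a)) (g : Hom a b) :
  descend (fhom G g ∘ u) = g ∘ descend u.
Proof.
by rewrite !descendE fhomM !compA (adj_counit_nat (rra_adj R)).
Qed.

(** The unit and counit are transformations of left module functors, so the two occurrences of the
    structure of F^ra cancel. [descend_rmod] is the same on the right. *)
Lemma descend_lmod x y a (u : Hom (F x) (G a)) :
  descend (bwd (lmod (bm_l G) y a) ∘ (idm (F y) ⊠ u) ∘ bwd (mon_two F y x))
  = idm y ⊠ descend u.
Proof.
have E := bi_counit_l (rra_adj R) y a; have U := bi_unit_l (ra_adj R) y x.
have N := lmod_nat (bm_l (ra R)) (idm y) u; rewrite /= fhom1 in N.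
rewrite !descendE !fhomM /ε' -E !bhomMr -U /= -!compA; congr (_ ∘ _).
rewrite (compA (fhom (ra R) (fwd _))) -fhomM bwdK fhom1 comp1m.
by rewrite !compA N.
Qed.

Lemma descend_rmod x y a (u : Hom (F x) (G a)) :
  descend (bwd (rmod (bm_r G) a y) ∘ (u ⊠ idm (F y)) ∘ bwd (mon_two F x y))
  = descend u ⊠ idm y.
Proof.
have E := bi_counit_r (rra_adj R) a y; have U := bi_unit_r (ra_adj R) x y.
have N := rmod_nat (bm_r (ra R)) u (idm y); rewrite /= fhom1 in N.
rewrite !descendE !fhomM /ε' -E !bhomMl -U /= -!compA; congr (_ ∘ _).
rewrite (compA (fhom (ra R) (fwd _))) -fhomM bwdK fhom1 comp1m.
by rewrite !compA N.
Qed.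

Definition ascend d a (w : Hom (ra R d) a) : Hom d (G a) := fhom G w ∘ η' d.

Lemma descend_ascend x d a (w : Hom (ra R d) a) (f : Hom (F x) d) :
  descend (ascend w ∘ f) = w ∘ (fhom (ra R) f ∘ η x).
Proof.
rewrite /ascend -compA descend_natr descendE fhomM.
by rewrite (compA (ε' _)) (adj_triangle_l (rra_adj R)) comp1m.
Qed.

(** On v ∘ ε, descent is the bijection Hom(d, F^rra a) ≅ Hom(F^ra d, a), with inverse [ascend]. *)
Lemma descend_inj d a (v v' : Hom d (G a)) :
  descend (v ∘ ε d) = descend (v' ∘ ε d) -> v = v'.
Proof.
have E u : ascend (descend (u ∘ ε d)) = u :> Hom d (G a).
  rewrite descendE fhomM -!compA (adj_triangle_r (ra_adj R)) compm1 /ascend.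
  rewrite fhomM -compA -(adj_unit_nat (rra_adj R)) compA.
  by rewrite (adj_triangle_r (rra_adj R)) comp1m.
by move=> e; rewrite -[v]E e E.
Qed.

End DoubleAdjoint.

(** * The trace on the restricted module and its universal property *)

Section RestrictedTrace.
Variables (k : fieldType) (C D : finite_tensor_category k).
Variables (F : tensor_functor C D) (R : double_right_adjoint F).
Variables (M : module_category D) (HD : internal_hom M).
Variable HC : internal_hom (restrict_module F M).
Implicit Types (a c x y : C) (m n : M).

Let G := rra R.
Let χ : D := modular_object R.
Let N := restrict_module F M.

Definition modular_trace m n (t : Hom (ihom HD m n) 𝟙) :
    Hom (ihom HC m (χ ▷ n)) 𝟙 :=
  locked_with seal
    (descend (partial_trace t (ihom_ev HC m (χ ▷ n) : Hom (F _ ▷ m) (χ ▷ n)))).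

Lemma modular_trace_curry x m n (t : Hom (ihom HD m n) 𝟙)
    (f : Hom (F x ▷ m) (χ ▷ n)) :
  modular_trace t ∘ ihom_curry HC (f : Hom ((x : C) ▷ (m : N)) (χ ▷ n : N))
  = descend (partial_trace t f).
Proof.
rewrite /modular_trace unlock -descend_natl -partial_trace_natx.
congr (descend (partial_trace t _)).
exact: (ihom_curryK HC (f : Hom ((x : C) ▷ (m : N)) (χ ▷ n : N))).
Qed.

(** The trace over D has values in F a ⊗ χ, which the left structure of F^rra identifies with F^rra
    a; [descend_lmod] then brings the coefficient a out of the descent. *)
Lemma modular_partial_trace a x m n (t : Hom (ihom HD m n) 𝟙)
    (f : Hom (F x ▷ m) (F a ▷ (χ ▷ n))) :
  partial_trace (modular_trace t)
    (f : Hom ((x : C) ▷ (m : N)) (a ▷ (χ ▷ n : N)))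
  = descend (fhom G (fwd (run a)) ∘ bwd (lmod (bm_l G) a 𝟙)
             ∘ partial_trace t (bwd (massoc (F a) χ n) ∘ f)).
Proof.
rewrite -(curK HC (f : Hom ((x : C) ▷ (m : N)) (a ▷ (χ ▷ n : N)))).
move: (cur HC _) => w; rewrite partial_trace_uncur.
have -> : uncur w = (idm (F a) ▶ (ihom_ev HC m (χ ▷ n) : Hom (F _ ▷ m) (χ ▷ n)))
    ∘ fwd (massoc (F a) (F _) m) ∘ ((bwd (mon_two F _ _) ∘ fhom F w) ▶ idm m).
  rewrite uncurE /= fhom1 bhomMl -!compA; congr (_ ∘ _).
rewrite !compA partial_trace_natx partial_trace_act.
rewrite !compA descend_natl; congr (_ ∘ _).
rewrite -!(compA (fhom G _)) descend_natr; congr (_ ∘ _).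
rewrite descend_lmod; congr (_ ⊠ _).
by rewrite /modular_trace unlock.
Qed.

Variables (T : twisted_functor M) (t : serre_trace HD T).

Let TC := lmod_twisted (modular_lmod R M) (restrict_twisted F T).

Definition modular_st (m : N) : Hom (ihom HC m (TC m)) 𝟙 :=
  modular_trace (st t m).

Lemma modular_st_nat (m m' : N) (f : Hom m m') :
  modular_st m ∘ ihom_mapl HC (TC m) f
  = modular_st m' ∘ ihom_mapr HC m' (fhom TC f).
Proof.
transitivity (descend (partial_trace (st t m)
  ((ihom_ev HC m' (TC m) : Hom (F _ ▷ (m' : M)) (χ ▷ T m))
     ∘ (idm (F _) ▶ (f : Hom (m : M) m'))))).
  rewrite -fhom1; exact: modular_trace_curry.
rewrite partial_trace_mapl st_nat -partial_trace_mapr.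
exact/esym/modular_trace_curry.
Qed.

(** F^ra takes internal Homs over D to internal Homs over C: [counit_ev] and the transpose of
    [ev_curry] under F ⊣ F^ra compare the two. *)
Let counit_ev m n : Hom (ra R (ihom HD m n)) (ihom HC m n) :=
  ihom_curry HC
    (ihom_ev HD m n ∘ (adj_counit (ra_adj R) (ihom HD m n) ▶ idm m)
     : Hom ((ra R (ihom HD m n) : C) ▷ (m : N)) (n : N)).

Let ev_curry m n : Hom (F (ihom HC m n)) (ihom HD m n) :=
  ihom_curry HD (ihom_ev HC m n : Hom (F _ ▷ (m : M)) n).

Lemma ev_curryE m n :
  ihom_ev HD m n ∘ (ev_curry m n ▶ idm m)
  = (ihom_ev HC m n : Hom (F _ ▷ (m : M)) n).
Proof. exact: ihom_curryK. Qed.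

Lemma ev_curry_counit m n :
  ev_curry m n ∘ fhom F (counit_ev m n) = adj_counit (ra_adj R) (ihom HD m n).
Proof.
apply: ihom_ext; rewrite bhomMl compA ev_curryE.
exact: (ihom_curryK HC (ihom_ev HD m n ∘ _ : Hom (_ ▷ (m : N)) (n : N))).
Qed.

Lemma counit_ev_curry m n :
  counit_ev m n ∘ (fhom (ra R) (ev_curry m n)
                     ∘ adj_unit (ra_adj R) (ihom HC m n)) = idm _.
Proof.
apply: ihom_ext; rewrite bhom1 compm1 bhomMl compA.
have -> : ihom_ev HC m n ∘ (counit_ev m n ▶ idm (m : N))
    = ihom_ev HD m n ∘ (adj_counit (ra_adj R) (ihom HD m n) ▶ idm m)
  by exact: ihom_curryK.
rewrite -[LHS]/(_ ∘ _ ∘ (fhom F _ ▶ idm (m : M))) fhomM -compA -bhomMl compA.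
rewrite (adj_counit_nat (ra_adj R)) -compA (adj_triangle_l (ra_adj R)) compm1.
exact: ev_curryE.
Qed.

Lemma modular_st_mapr (m n : N) (f : Hom n (TC m)) :
  modular_st m ∘ ihom_mapr HC m f
  = descend (partial_trace (st t m)
      ((f : Hom (n : M) (χ ▷ T m)) ∘ ihom_ev HD m n) ∘ ev_curry m n).
Proof.
rewrite -partial_trace_natx -compA ev_curryE.
exact: modular_trace_curry.
Qed.

(** The functional is pulled back to F^ra of the internal Hom over D, moved across F^ra ⊣ F^rra to a
    morphism with values in χ, and lifted with coefficient χ. *)
Definition modular_lift (m n : N) (w : Hom (ihom HC m n) 𝟙) : Hom n (TC m) :=
  coef_lift t (ascend (w ∘ counit_ev m n)).

Lemma modular_liftK (m n : N) (w : Hom (ihom HC m n) 𝟙) :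
  modular_st m ∘ ihom_mapr HC m (modular_lift w) = w.
Proof.
rewrite modular_st_mapr coef_liftK descend_ascend -compA counit_ev_curry.
by rewrite compm1.
Qed.

Lemma modular_st_inj (m n : N) (f g : Hom n (TC m)) :
  modular_st m ∘ ihom_mapr HC m f = modular_st m ∘ ihom_mapr HC m g -> f = g.
Proof.
rewrite !modular_st_mapr => e.
apply: (partial_trace_inj (t := t)); apply: descend_inj.
(* The counit factors through [ev_curry], where the hypothesis applies. *)
by rewrite -ev_curry_counit !compA !descend_natl e.
Qed.

End RestrictedTrace.

(** * The half braiding and the twisted structure *)

Section RestrictedStructure.
Variables (k : fieldType) (C D : finite_tensor_category k).
Variables (F : tensor_functor C D) (R : double_right_adjoint F).

Let G := rra R.
Let χ : D := modular_object R.

Lemma ev_act_restrict (M : module_category D) (c : C) (m : M) :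
  ev_act (mod_act (restrict_module F M)) (ev (rdualP c)) m
  = ev_act (mod_act M) (mon_ev F c) m.
Proof. by rewrite !ev_actE /= !bhomMl !compA. Qed.

(** Coherence of the right structure of F^rra moves the contraction of F(c^∨) ⊗ F(c) next to χ =
    F^rra 1 inside F^rra. *)
Lemma modular_mon_ev (c : C) :
  fwd (run χ) ∘ (idm χ ⊠ mon_ev F c) ∘ fwd (assoc χ (F (c^∨)) (F c))
  = fhom G (ev (rdualP c)) ∘ bwd (rmod (bm_r G) (c^∨) c)
    ∘ ((fhom G (fwd (lun (c^∨))) ∘ bwd (rmod (bm_r G) 𝟙 (c^∨))) ⊠ idm (F c)).
Proof.
apply: (iso_epi (i := bifunctor_iso tens (rmod (bm_r G) 𝟙 (c^∨)) (iso_refl (F c)))).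
apply: (iso_epi (i := rmod (bm_r G) (𝟙 ⊗ c^∨) c)).
have Ra := rmod_assoc (bm_r G) (𝟙 : C) (c^∨) c.
have Rn := rmod_nat (bm_r G) (fwd (lun (c^∨))) (idm c).
have Re := rmod_nat (bm_r G) (idm (𝟙 : C)) (ev (rdualP c)).
have Ru := rmod_unit (bm_r G) (𝟙 : C).
rewrite /= ?fhom1 in Rn Ra Re Ru.
rewrite /= /mon_ev !bhomMr -!compA.
rewrite -!compA in Ra; rewrite -Ra (compA (_ ⊠ fhom F _)) -Re.
rewrite !compA Ru -!fhomM -!compA.
rewrite (compA ((_ ∘ _) ⊠ _)) -bhomMl -compA fwdK compm1 -Rn.
rewrite (compA (bwd _)) fwdK comp1m -fhomM; congr (fhom G _).
rewrite -lun_one !compA lun_nat -!compA; congr (_ ∘ _).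
exact: lun_assoc.
Qed.

End RestrictedStructure.

Section RestrictedStr.
Variables (k : fieldType) (C D : finite_tensor_category k).
Variables (F : tensor_functor C D) (R : double_right_adjoint F).
Variables (M : module_category D) (HD : internal_hom M).
Variable HC : internal_hom (restrict_module F M).
Variables (T : twisted_functor M) (t : serre_trace HD T).

Let G := rra R.
Let χ : D := modular_object R.
Let A := mod_act M.
Let N := restrict_module F M.
Let TC := lmod_twisted (modular_lmod R M) (restrict_twisted F T).
Let σ := hb (modular_half_braiding R).

(** Both paths identify χ ⊗ F c with F^rra c. The equation trades the left structure of F^rra for
    the right one. *)
Lemma modular_hbE (c : C) :
  fhom G (fwd (run c)) ∘ bwd (lmod (bm_l G) c 𝟙) ∘ fwd (σ c)
  = fhom G (fwd (lun c)) ∘ bwd (rmod (bm_r G) 𝟙 c).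
Proof.
rewrite /σ /= -!compA (compA (bwd _)) fwdK comp1m compA -fhomM.
by rewrite compA bwdK comp1m.
Qed.

(** The left side has c^∨ to the right of Hom(m, -), which calls for [descend_rmod]; the right side
    has c^∨∨ to the left of χ, which calls for [modular_partial_trace]. The half braiding in the
    twisted structure reconciles them through [modular_hbE]. *)
Lemma modular_st_str (c : C) (m : N) :
  modular_st R HC t (c ▷ m) ∘ ihom_actl HC c m (TC (c ▷ m))
  = ev (rdualP (c^∨))
    ∘ (partial_trace (modular_st R HC t m)
         (tw_str TC c m ∘ ihom_ev HC m (TC (c ▷ m))) ⊠ idm (c^∨)).
Proof.
set h := ihom HC m (TC (c ▷ m)).
pose e : Hom (F h ▷ (m : M)) (χ ▷ T (F c ▷ m)) := ihom_ev HC m (TC (c ▷ m)).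
pose W := partial_trace (st t m)
  (bwd (massoc χ ((F c)^∨^∨) (T m)) ∘ (idm χ ▶ tw_str T (F c) m) ∘ e).
pose W' := (idm χ ⊠ mon_double_dual F c) ∘ W.
have -> : modular_st R HC t (c ▷ m) ∘ ihom_actl HC c m (TC (c ▷ m))
  = descend (partial_trace (st t (F c ▷ m))
      (e ∘ (idm (F h) ▶ ev_act A (mon_ev F c) m)
         ∘ fwd (massoc (F h) (F (c^∨)) (F c ▷ m))
         ∘ (bwd (mon_two F h (c^∨)) ▶ idm (F c ▷ m)))).
  rewrite -compA -(fhom1 F h) -ev_act_restrict [ev_act _ _ _]ev_actE.
  exact: modular_trace_curry.
(* The image under F of the evaluation of c is exchanged for the evaluation of F c along [mon_dual],
   so that the trace of T over D applies. *)
rewrite partial_trace_natx -(ev_mon_dual F c) (ev_act_comp A).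
rewrite bhomMr compA -(compA _ (bhom _ _ (bhom _ _ _))) -(lassoc_natm A) compA.
rewrite partial_trace_natx partial_trace_str -/W.
have -> : partial_trace (modular_st R HC t m)
    (tw_str TC c m ∘ ihom_ev HC m (TC (c ▷ m)))
  = descend (fhom G (fwd (lun (c^∨^∨))) ∘ bwd (rmod (bm_r G) 𝟙 (c^∨^∨)) ∘ W').
  rewrite -modular_hbE -(compA _ (fwd (σ _))).
  have -> : fwd (σ (c^∨^∨)) ∘ W' = partial_trace (st t m)
      (bwd (massoc (F (c^∨^∨)) χ (T m)) ∘ (tw_str TC c m ∘ ihom_ev HC m _)).
    rewrite /W' -!partial_trace_nata; congr partial_trace.
    have -> : tw_str TC c m = fwd (massoc (F (c^∨^∨)) χ (T m))
        ∘ ((fwd (σ (c^∨^∨)) ▶ idm (T m)) ∘ (bwd (massoc χ (F (c^∨^∨)) (T m))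
        ∘ (idm χ ▶ ((mon_double_dual F c ▶ idm (T m)) ∘ tw_str T (F c) m)))).
      by rewrite /TC /= !compA.
    rewrite !compA fwdK comp1m -!compA; congr (_ ∘ _).
    rewrite bhomMr !compA; congr (_ ∘ _ ∘ _).
    exact/esym/(lassoc_bwd_nat A).
  exact: modular_partial_trace.
(* Both sides are compared before descent: [modular_mon_ev] removes F^rra, and [ev_mon_double_dual]
   matches the double duals. *)
rewrite -descend_rmod -descend_natr; congr (descend _).
rewrite bhomMl !compA -modular_mon_ev; congr (_ ∘ _).
rewrite -!compA; congr (_ ∘ _).
have As := assoc_nat (idm χ) (mon_double_dual F c) (idm (F (c^∨))).
rewrite /W' bhomMl (compA (fwd (assoc _ (F _) _))) As !compA -!bhomMr.
rewrite ev_mon_double_dual bhomMr -!compA; congr (_ ∘ _).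
rewrite -bhom_lr (bhom_rl _ W) compA.
have As' := assoc_nat (idm χ) (idm ((F c)^∨^∨)) (mon_dual F c).
by rewrite bhom1 in As'; rewrite As' -compA.
Qed.

Definition modular_serre_trace : serre_trace HC TC :=
  @SerreTrace k C N HC TC (modular_st R HC t) (@modular_st_nat _ _ _ _ R _ _ HC _ t)
    (@modular_lift _ _ _ _ R _ _ HC _ t) (@modular_liftK _ _ _ _ R _ _ HC _ t)
    (@modular_st_inj _ _ _ _ R _ _ HC _ t) modular_st_str.

End RestrictedStr.

Theorem proposition4p14 (k : closedFieldType)
    (C D : finite_tensor_category k) (F : tensor_functor C D)
    (perfectF : perfect F) (R : double_right_adjoint F)
    (M : module_category D) (exactM : exact_module M)
    (HD : internal_hom M) (SD : relative_serre HD)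
    (HC : internal_hom (restrict_module F M)) (SC : relative_serre HC) :
  inhabited (twisted_iso
    (lmod_twisted (modular_lmod R M) (restrict_twisted F (serre_twisted SD)))
    (serre_twisted SC)).
Proof.
constructor; apply: serre_trace_iso (serre_twisted_trace SC).
exact: modular_serre_trace (serre_twisted_trace SD).
Qed.
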